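(* Let $d\in\mathbb{N}$, let $X_S=\{\mathrm{x}_1,\dots,\mathrm{x}_{d-1}\}$ be a solution of the E-system, parametrized by the non-empty subset $S$ of $\mathbb{Z}/d\mathbb{Z}$, and let $\mathrm{tr}_S$ be the corresponding specialized Juyumaya trace on the Yokonuma-Hecke algebras $\mathrm{Y}_{d,n}(u)$ with parameter $z$. Let $\tau$ be the Ocneanu trace on the Iwahori-Hecke algebras $\mathcal{H}_n(q)$ with parameter $\zeta$, and let $E=\mathrm{tr}_S(e_i)$ (which does not depend on $i$). Let $P$ be the link invariant obtained from $\tau$ and $\Delta_S$ the link invariant obtained from $\mathrm{tr}_S$. Then $P=\Delta_S$ (as maps on the set of isotopy classes of oriented links in $S^3$) if and only if the values $(q,\zeta,u,z,E)$ satisfy one of the following (where any parameter among $q,\zeta,u,z$ on which no condition is listed is an arbitrary element of $\mathbb{C}^*$, and $E$ is arbitrary when not mentioned): (1) $q=1$, $\zeta=z$, $u=1$; (2) $q=1$, $\zeta=-z$, $u=1$; (3) $\zeta=q$, $u=1$, $z=1$; (4) $\zeta=q$, $u=1$, $z=-1$; (5) $\zeta=-1$, $u=1$, $z=1$; (6) $\zeta=-1$, $u=1$, $z=-1$; (7) $q=1$, $\zeta=E$, $z=-E$; (8) $q=1$, $\zeta=-E$, $z=-E$; (9) $\zeta=q$, $z=-1$, $E=1$; (10) $\zeta=q$, $z=u$, $E=1$; (11) $\zeta=-1$, $z=-1$, $E=1$; (12) $\zeta=-1$, $z=u$, $E=1$; (13) $q=u$, $\zeta=z$, $E=1$; (14)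 $q=1/u$, $\zeta=-z/u$, $E=1$.
   Context: Parameters: $q,\zeta,u,z\in\mathbb{C}^*=\mathbb{C}\setminus\{0\}$ (trace parameters $\zeta,z$ specialized to complex numbers), such that $\lambda_{\mathcal H}:=\frac{\zeta+(1-q)}{q\zeta}$ and $\lambda_{\mathrm Y}:=\frac{z+(1-u)E}{uz}$ are nonzero. Iwahori-Hecke algebra $\mathcal{H}_n(q)$: the associative $\mathbb{C}$-algebra generated by $G_1,\dots,G_{n-1}$ with relations $G_iG_j=G_jG_i$ for $|i-j|>1$, $G_{i+1}G_iG_{i+1}=G_iG_{i+1}G_i$, $G_i^2=(q-1)G_i+q$. We use the natural inclusions $\mathcal{H}_n(q)\subset\mathcal{H}_{n+1}(q)$, $\mathcal H_0(q)=\mathbb C$. The Ocneanu trace with parameter $\zeta$ is the unique linear map $\tau$ on $\bigcup_n\mathcal{H}_n(q)$ with $\tau(hh')=\tau(h'h)$, $\tau(1)=1$, $\tau(hG_n)=\zeta\,\tau(h)$ for $h,h'\in\mathcal{H}_n(q)$ and all $n$. Yokonuma-Hecke algebra $\mathrm{Y}_{d,n}(u)$: the associative $\mathbb{C}$-algebra generated by $g_1,\dots,g_{n-1},t_1,\dots,t_n$ with relations $g_ig_j=g_jg_i$ for $|i-j|>1$; $g_ig_jg_i=g_jg_ig_j$ for $|i-j|=1$; $t_it_j=t_jt_i$; $t_jg_i=g_it_{s_i(j)}$ where $s_i=(i,i+1)$; $t_j^d=1$; and $g_i^2=1+(u-1)e_i+(u-1)e_ig_i$, where $e_i:=\frac1d\sum_{s=0}^{d-1}t_i^st_{i+1}^{-s}$.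 We use the natural inclusions $\mathrm{Y}_{d,n}(u)\subset\mathrm{Y}_{d,n+1}(u)$, $\mathrm Y_{d,0}(u)=\mathbb C$. The Juyumaya trace with parameters $z,x_1,\dots,x_{d-1}$ is the unique linear map $\mathrm{tr}$ on $\bigcup_n\mathrm{Y}_{d,n}(u)$ with $\mathrm{tr}(ab)=\mathrm{tr}(ba)$, $\mathrm{tr}(1)=1$, $\mathrm{tr}(ag_n)=z\,\mathrm{tr}(a)$, $\mathrm{tr}(at_{n+1}^m)=x_m\mathrm{tr}(a)$ ($1\le m\le d-1$) for $a,b\in\mathrm{Y}_{d,n}(u)$ and all $n$. E-system: the system $\sum_{s=0}^{d-1}x_{m+s}x_{d-s}=x_m\sum_{s=0}^{d-1}x_sx_{d-s}$ for $1\le m\le d-1$, with indices modulo $d$ and $x_0:=1$. Its complex solutions are parametrized by the non-empty subsets $S$ of $\mathbb{Z}/d\mathbb{Z}$; $\mathrm{tr}_S$ denotes $\mathrm{tr}$ with $x_m$ specialized to $\mathrm{x}_m$, where $X_S=\{\mathrm{x}_1,\dots,\mathrm{x}_{d-1}\}$ is the solution attached to $S$. One has $E=\mathrm{tr}_S(e_i)=\frac1d\sum_{s=0}^{d-1}\mathrm{x}_s\mathrm{x}_{d-s}=1/|S|$. Invariants: let $B_n$ be the braid group with generators $\sigma_1,\dots,\sigma_{n-1}$, $\widehat\alpha$ the closure of the braid $\alpha$, $\epsilon(\alpha)$ the sum of the exponents of the generators in a braid word for $\alpha$, $\pi:\mathbb{C}B_n\to\mathcal{H}_n(q)$, $\sigma_i\mapsto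 G_i$, and $\delta:\mathbb{C}B_n\to\mathrm{Y}_{d,n}(u)$, $\sigma_i\mapsto g_i$, the natural algebra homomorphisms. Put $D_{\mathcal H}:=\frac{1}{\zeta\sqrt{\lambda_{\mathcal H}}}$ and $D_{\mathrm Y}:=\frac{1}{z\sqrt{\lambda_{\mathrm Y}}}$. For $\alpha\in B_n$, $P(\widehat\alpha):=D_{\mathcal H}^{\,n-1}(\sqrt{\lambda_{\mathcal H}})^{\epsilon(\alpha)}\,\tau(\pi(\alpha))$ and $\Delta_S(\widehat\alpha):=D_{\mathrm Y}^{\,n-1}(\sqrt{\lambda_{\mathrm Y}})^{\epsilon(\alpha)}\,\mathrm{tr}_S(\delta(\alpha))$. These are well-defined on isotopy classes of oriented links ($P$ is the HOMFLYPT polynomial). Square roots are chosen compatibly: if $\zeta^2\lambda_{\mathcal H}=z^2\lambda_{\mathrm Y}$, they are chosen so that $\zeta\sqrt{\lambda_{\mathcal H}}=z\sqrt{\lambda_{\mathrm Y}}$. *)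

(* Defs.v *)
From HB Require Import structures.
From mathcomp Require Import all_boot all_order all_algebra perm.
From mathcomp Require Import zify.
From mathcomp Require Import boolp reals.
From mathcomp Require Import complex.
From mathcomp Require Import finmap monalg.

Set Implicit Arguments.
Unset Strict Implicit.
Unset Printing Implicit Defensive.

Import GRing.Theory Num.Theory.
Local Open Scope quotient_scope.
Local Open Scope ring_scope.

Fact presented_key : unit. Proof. by []. Qed.

Fact addr_sub (V : zmodType) (a c : V) : a + c - a = c.
Proof. by rewrite [a + c]addrC addrK. Qed.

Fact addr_subC (V : zmodType) (a b c d : V) : a + c + (b + d) - (a + b) = c + d.
Proof. by rewrite addrACA [a + b + _]addrC addrK. Qed.

Fact mulr_subC (R : pzRingType) (a b c d : R) :
  (a + c) * (b + d) - a * b = a * d + c * (b + d).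
Proof. by rewrite mulrDl [a * (b + d)]mulrDr -(addrA (a * b)) addr_sub. Qed.

Section FreeAlgebra.
Variables (K : comNzRingType) (I : choiceType).

(* The free associative unital K-algebra on I: the algebra of the free monoid
   of words in I. *)
Definition word_alg := {malg K[{fmonom I}]}.
HB.instance Definition _ := GRing.Lalgebra.on word_alg.

Fact word_alg_scalerAr (k : K) (x y : word_alg) : k *: (x * y) = x * (k *: y).
Proof.
apply/malgP => m; rewrite mcoeffZ.
have lex : (msupp x `<=` msupp x)%fset by [].
have ley : (msupp y `<=` msupp y)%fset by [].
apply: etrans (congr1 ( *%R k) (mcoeffMlw m lex ley)) _.
apply: etrans _ (esym (mcoeffMlw m lex (msuppZ_le k y))).
rewrite mulr_sumr; apply: eq_bigr => a _.
rewrite mulr_sumr; apply: eq_bigr => b _.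
by rewrite mcoeffZ mulrnAr mulrCA.
Qed.
HB.instance Definition _ :=
  GRing.Lalgebra_isAlgebra.Build K word_alg word_alg_scalerAr.

Definition word_gen (i : I) : word_alg := << fmu i >>.

Fact word_alg_ind (Q : word_alg -> Prop) :
  Q 1 -> (forall i, Q (word_gen i)) -> (forall x y, Q x -> Q y -> Q (x + y)) ->
  (forall k x, Q x -> Q (k *: x)) -> (forall x y, Q x -> Q y -> Q (x * y)) ->
  forall x, Q x.
Proof.
move=> Q1 Qgen QD QZ QM x; rewrite [x]monalgE.
have Q0 : Q 0 by rewrite -[0](scale0r 1); apply: QZ.
apply: big_ind => // m _.
have -> : << x@_m *g m >> = x@_m *: << m >> :> word_alg.
  by apply/malgP => k; rewrite mcoeffZ !mcoeffU mulrnAr mulr1.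
apply: QZ; case: m => w; elim: w => [|i w IHw].
  by rewrite -fmoneE.
have -> : FMonom (i :: w) = mmul (fmu i) (FMonom w).
  by apply/val_inj; rewrite /= fmM fmU.
have -> : << (mmul (fmu i) (FMonom w)) >> = word_gen i * << FMonom w >> :> word_alg.
  by rewrite /word_gen malgM_def fgmulUU mulr1.
exact: QM.
Qed.

Section Eval.
Variables (A : algType K) (f : I -> A).

Definition fmonom_eval (m : {fmonom I}) : A := \prod_(i <- (m : seq I)) f i.

Fact fmonom_eval_mmorphism : mmorphism fmonom_eval.
Proof.
split=> [x y|]; rewrite /fmonom_eval; first by rewrite fmM big_cat.
by rewrite fm1 big_nil.
Qed.
HB.instance Definition _ :=
  monalg.isMultiplicative.Build _ A fmonom_eval fmonom_eval_mmorphism.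

Definition word_eval (x : word_alg) : A := mmap (in_alg A) fmonom_eval x.

Fact word_eval_zmod_morphism : zmod_morphism word_eval.
Proof. exact: mmap_is_additive. Qed.
HB.instance Definition _ :=
  GRing.isZmodMorphism.Build _ _ word_eval word_eval_zmod_morphism.

Fact word_eval_monoid_morphism : monoid_morphism word_eval.
Proof.
have [fM f1] : GRing.multiplicative word_eval; last by split.
apply: commr_mmap_is_multiplicative => g m m'.
by rewrite /GRing.comm mulr_algl mulr_algr.
Qed.
HB.instance Definition _ :=
  GRing.isMonoidMorphism.Build _ _ word_eval word_eval_monoid_morphism.

Fact word_eval_scalable : scalable word_eval.
Proof. by move=> k x; rewrite /word_eval mmapZ mulr_algl. Qed.
HB.instance Definition _ :=
  GRing.isScalable.Build K word_alg A *:%R word_eval word_eval_scalable.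

Fact word_eval_gen i : word_eval (word_gen i) = f i.
Proof.
rewrite /word_eval /word_gen mmapU /= scale1r mul1r /fmonom_eval.
by rewrite fmU big_seq1.
Qed.

End Eval.

(* [free_alg] is [word_alg] with its structure locked: unification must not
   unfold the operations of [word_alg]. *)
Record free_package := FreePackage {
  fp_alg : algType K;
  fp_gen : I -> fp_alg;
  fp_eval : forall A : algType K, (I -> A) -> {lrmorphism fp_alg -> A};
  fp_eval_gen : forall (A : algType K) (f : I -> A) i,
    fp_eval f (fp_gen i) = f i;
  fp_ind : forall Q : fp_alg -> Prop, Q 1 -> (forall i, Q (fp_gen i)) ->
    (forall x y, Q x -> Q y -> Q (x + y)) ->
    (forall k x, Q x -> Q (k *: x)) ->
    (forall x y, Q x -> Q y -> Q (x * y)) -> forall x, Q x }.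

Definition word_package := locked_with presented_key
  (@FreePackage word_alg word_gen (fun A f => word_eval f) word_eval_gen
     word_alg_ind).

Definition free_alg : algType K := fp_alg word_package.
Definition fgen : I -> free_alg := fp_gen word_package.

Variables (A : algType K) (f : I -> A).

Definition feval : {lrmorphism free_alg -> A} := fp_eval word_package f.

Lemma feval_gen i : feval (fgen i) = f i.
Proof. exact: fp_eval_gen. Qed.

Lemma fevalZ k x : feval (k *: x) = k *: feval x.
Proof. exact: linearZ. Qed.

End FreeAlgebra.
Arguments fgen {K I} i.

Section PresentedAlgebra.
Variable K : comNzRingType.

Inductive relation_ideal (I : choiceType)
    (r : free_alg K I -> free_alg K I -> Prop) : free_alg K I -> Prop :=
| Ideal_rel x y of r x y : relation_ideal r (x - y)
| Ideal_0 : relation_ideal r 0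
| Ideal_add x y of relation_ideal r x & relation_ideal r y :
    relation_ideal r (x + y)
| Ideal_mull a x of relation_ideal r x : relation_ideal r (a * x)
| Ideal_mulr a x of relation_ideal r x : relation_ideal r (x * a).

Record presentation := Presentation {
  pres_gen : choiceType;
  pres_rel : free_alg K pres_gen -> free_alg K pres_gen -> Prop;
  (* needed only because an algType is a non-zero ring *)
  pres_consistent : ~ relation_ideal pres_rel 1 }.

Variable P : presentation.
Local Notation F := (free_alg K (pres_gen P)).
Local Notation ideal := (relation_ideal (@pres_rel P)).

Fact ideal_opp x : ideal x -> ideal (- x).
Proof. by rewrite -mulN1r; apply: Ideal_mull. Qed.

Definition pres_eqv : rel F := fun x y => `[< ideal (x - y) >].

Fact pres_eqv_refl : reflexive pres_eqv.
Proof. by move=> x; apply/asboolP; rewrite subrr; apply: Ideal_0. Qed.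
Fact pres_eqv_sym : symmetric pres_eqv.
Proof.
by move=> x y; apply/asboolP/asboolP => /ideal_opp; rewrite opprB.
Qed.
Fact pres_eqv_trans : transitive pres_eqv.
Proof.
move=> y x z /asboolP xy /asboolP yz; apply/asboolP.
by rewrite -(subrKA y); apply: Ideal_add.
Qed.
Canonical pres_equiv :=
  EquivRel pres_eqv pres_eqv_refl pres_eqv_sym pres_eqv_trans.

Definition presented := {eq_quot pres_equiv}.
HB.instance Definition _ := Choice.on presented.
HB.instance Definition _ := EqQuotient.on presented.

Definition pres_class : F -> presented :=
  locked_with presented_key (fun x => \pi_presented x).
Fact pres_classE x : pres_class x = \pi_presented x.
Proof. by rewrite /pres_class locked_withE. Qed.

Fact pres_classP x y : pres_class x = pres_class y <-> ideal (x - y).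
Proof.
rewrite !pres_classE.
by split=> [/eqmodP /asboolP //|xy]; apply/eqmodP; exact/asboolP.
Qed.

Fact repr_class x : exists2 z, ideal z & repr (pres_class x) = x + z.
Proof.
exists (repr (pres_class x) - x); last by rewrite addrC subrK.
by apply/pres_classP; rewrite pres_classE reprK.
Qed.

Definition pres_zero := pres_class 0.
Definition pres_one := pres_class 1.
Definition pres_opp := locked_with presented_key
  (fun x : presented => pres_class (- repr x)).
Definition pres_add := locked_with presented_key
  (fun x y : presented => pres_class (repr x + repr y)).
Definition pres_mul := locked_with presented_key
  (fun x y : presented => pres_class (repr x * repr y)).
Definition pres_scale := locked_with presented_key
  (fun (k : K) (x : presented) => pres_class (k *: repr x)).

Fact class_opp x : pres_opp (pres_class x) = pres_class (- x).
Proof.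
rewrite /pres_opp locked_withE; apply/pres_classP.
have [z Iz ->] := repr_class x.
by rewrite opprD addr_sub; apply: ideal_opp.
Qed.
Fact class_add x y :
  pres_add (pres_class x) (pres_class y) = pres_class (x + y).
Proof.
rewrite /pres_add locked_withE; apply/pres_classP.
have [z Iz ->] := repr_class x; have [t It ->] := repr_class y.
by rewrite addr_subC; apply: Ideal_add.
Qed.
Fact class_mul x y :
  pres_mul (pres_class x) (pres_class y) = pres_class (x * y).
Proof.
rewrite /pres_mul locked_withE; apply/pres_classP.
have [z Iz ->] := repr_class x; have [t It ->] := repr_class y.
by rewrite mulr_subC; apply: Ideal_add; [apply: Ideal_mull|apply: Ideal_mulr].
Qed.
Fact class_scale k x : pres_scale k (pres_class x) = pres_class (k *: x).
Proof.
rewrite /pres_scale locked_withE; apply/pres_classP.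
have [z Iz ->] := repr_class x.
rewrite scalerDr addr_sub -[z]mul1r scalerAl.
exact: Ideal_mull.
Qed.

Fact presW (Q : presented -> Prop) :
  (forall x, Q (pres_class x)) -> forall x, Q x.
Proof. by move=> h x; rewrite -[x]reprK -pres_classE; apply: h. Qed.

Fact pres_addA : associative pres_add.
Proof.
by elim/presW => x; elim/presW => y; elim/presW => z; rewrite !class_add addrA.
Qed.
Fact pres_addC : commutative pres_add.
Proof. by elim/presW => x; elim/presW => y; rewrite !class_add addrC. Qed.
Fact pres_add0 : left_id pres_zero pres_add.
Proof. by elim/presW => x; rewrite class_add add0r. Qed.
Fact pres_addN : left_inverse pres_zero pres_opp pres_add.
Proof. by elim/presW => x; rewrite class_opp class_add addNr. Qed.
HB.instance Definition _ := GRing.isZmodule.Build presented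
  pres_addA pres_addC pres_add0 pres_addN.

Fact pres_mulA : associative pres_mul.
Proof.
by elim/presW => x; elim/presW => y; elim/presW => z; rewrite !class_mul mulrA.
Qed.
Fact pres_mul1l : left_id pres_one pres_mul.
Proof. by elim/presW => x; rewrite class_mul mul1r. Qed.
Fact pres_mul1r : right_id pres_one pres_mul.
Proof. by elim/presW => x; rewrite class_mul mulr1. Qed.
Fact pres_mulDl : left_distributive pres_mul +%R.
Proof.
elim/presW => x; elim/presW => y; elim/presW => z.
by rewrite /GRing.add /= class_add !class_mul class_add mulrDl.
Qed.
Fact pres_mulDr : right_distributive pres_mul +%R.
Proof.
elim/presW => x; elim/presW => y; elim/presW => z.
by rewrite /GRing.add /= class_add !class_mul class_add mulrDr.
Qed.
Fact pres_one_neq0 : pres_one != 0.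
Proof.
apply/eqP => /pres_classP; rewrite subr0; exact: pres_consistent.
Qed.
HB.instance Definition _ := GRing.Zmodule_isNzRing.Build presented
  pres_mulA pres_mul1l pres_mul1r pres_mulDl pres_mulDr pres_one_neq0.

Fact pres_scaleA a b x :
  pres_scale a (pres_scale b x) = pres_scale (a * b) x.
Proof. by elim/presW: x => x; rewrite !class_scale scalerA. Qed.
Fact pres_scale1 : left_id 1 pres_scale.
Proof. by elim/presW => x; rewrite class_scale scale1r. Qed.
Fact pres_scaleDr : right_distributive pres_scale +%R.
Proof.
move=> k; elim/presW => x; elim/presW => y.
by rewrite /GRing.add /= class_add !class_scale class_add scalerDr.
Qed.
Fact pres_scaleDl x : {morph pres_scale^~ x : a b / a + b}.
Proof.
elim/presW: x => x a b.
by rewrite !class_scale scalerDl [in RHS]/GRing.add /= class_add.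
Qed.
HB.instance Definition _ := GRing.Zmodule_isLmodule.Build K presented
  pres_scaleA pres_scale1 pres_scaleDr pres_scaleDl.

Fact pres_scaleAl (k : K) (x y : presented) : k *: (x * y) = (k *: x) * y.
Proof.
elim/presW: x => x; elim/presW: y => y; rewrite /GRing.scale /GRing.mul /=.
by rewrite class_mul !class_scale class_mul scalerAl.
Qed.
HB.instance Definition _ :=
  GRing.Lmodule_isLalgebra.Build K presented pres_scaleAl.

Fact pres_scaleAr (k : K) (x y : presented) : k *: (x * y) = x * (k *: y).
Proof.
elim/presW: x => x; elim/presW: y => y; rewrite /GRing.scale /GRing.mul /=.
by rewrite class_mul !class_scale class_mul scalerAr.
Qed.
HB.instance Definition _ :=
  GRing.Lalgebra_isAlgebra.Build K presented pres_scaleAr.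

Fact pres_class_nmod : nmod_morphism pres_class.
Proof. by split=> // x y; rewrite -class_add. Qed.
HB.instance Definition _ :=
  GRing.isNmodMorphism.Build F presented pres_class pres_class_nmod.
Fact pres_class_monoid : monoid_morphism pres_class.
Proof. by split=> // x y; rewrite -class_mul. Qed.
HB.instance Definition _ :=
  GRing.isMonoidMorphism.Build F presented pres_class pres_class_monoid.
Fact pres_class_scalable : scalable pres_class.
Proof. by move=> k x; rewrite -class_scale. Qed.
HB.instance Definition _ :=
  GRing.isScalable.Build K F presented *:%R pres_class pres_class_scalable.

Lemma pclassM x y : pres_class (x * y) = pres_class x * pres_class y.
Proof. exact: rmorphM. Qed.
Lemma pclassD x y : pres_class (x + y) = pres_class x + pres_class y.
Proof. exact: rmorphD. Qed.
Lemma pclassX x n : pres_class (x ^+ n) = pres_class x ^+ n.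
Proof. exact: rmorphXn. Qed.
Lemma pclassZ k x : pres_class (k *: x) = k *: pres_class x.
Proof. exact: linearZ. Qed.
Lemma pclass1 : pres_class 1 = 1.
Proof. exact: rmorph1. Qed.

Definition pgen (i : pres_gen P) : presented := pres_class (fgen i).

Lemma presented_ind (Q : presented -> Prop) :
  Q 1 -> (forall i, Q (pgen i)) -> (forall x y, Q x -> Q y -> Q (x + y)) ->
  (forall k x, Q x -> Q (k *: x)) -> (forall x y, Q x -> Q y -> Q (x * y)) ->
  forall x, Q x.
Proof.
move=> Q1 Qgen QD QZ QM; apply: presW.
apply: fp_ind => [|i|x y Qx Qy|k x Qx|x y Qx Qy].
- by rewrite pclass1.
- exact: Qgen.
- by rewrite pclassD; apply: QD.
- by rewrite pclassZ; apply: QZ.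
- by rewrite pclassM; apply: QM.
Qed.

Lemma pres_relE x y : pres_rel x y -> pres_class x = pres_class y.
Proof. by move=> xy; apply/pres_classP; apply: Ideal_rel. Qed.

End PresentedAlgebra.

Lemma feval_ideal (K : comNzRingType) (I : choiceType)
    (r : free_alg K I -> free_alg K I -> Prop) (A : algType K) (f : I -> A) :
  (forall x y, r x y -> feval f x = feval f y) ->
  forall x, relation_ideal r x -> feval f x = 0.
Proof.
move=> fr x; elim=> {x} [x y /fr xy||x y _ x0 _ y0|a x _ x0|a x _ x0].
- by rewrite rmorphB /= xy subrr.
- by rewrite rmorph0.
- by rewrite rmorphD /= x0 y0 addr0.
- by rewrite rmorphM /= x0 mulr0.
- by rewrite rmorphM /= x0 mul0r.
Qed.

Section PresentedLift.
Variables (K : comNzRingType) (P : presentation K) (A : algType K).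
Variables (f : pres_gen P -> A).
Hypothesis fP : forall x y, @pres_rel K P x y -> feval f x = feval f y.

Definition pres_lift of (forall x y, @pres_rel K P x y -> feval f x = feval f y)
  : presented P -> A := locked_with presented_key (fun x => feval f (repr x)).
Local Notation lift := (pres_lift fP).

Fact pres_lift_class x : lift (pres_class x) = feval f x.
Proof.
rewrite /pres_lift locked_withE; have [z Iz ->] := repr_class x.
by rewrite rmorphD /= (feval_ideal fP Iz) addr0.
Qed.

Fact pres_lift_nmod : nmod_morphism lift.
Proof.
split; first by rewrite -(rmorph0 (pres_class (P := P))) pres_lift_class rmorph0.
elim/presW => x; elim/presW => y.
by rewrite -(rmorphD (pres_class (P := P))) !pres_lift_class rmorphD.
Qed.
HB.instance Definition _ :=
  GRing.isNmodMorphism.Build (presented P) A lift pres_lift_nmod.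
Fact pres_lift_monoid : monoid_morphism lift.
Proof.
split; first by rewrite -(rmorph1 (pres_class (P := P))) pres_lift_class rmorph1.
elim/presW => x; elim/presW => y.
by rewrite -(rmorphM (pres_class (P := P))) !pres_lift_class rmorphM.
Qed.
HB.instance Definition _ :=
  GRing.isMonoidMorphism.Build (presented P) A lift pres_lift_monoid.
Fact pres_lift_scalable : scalable lift.
Proof.
move=> k; elim/presW => x.
have -> : k *: pres_class x = pres_class (k *: x) by rewrite linearZ.
by rewrite !pres_lift_class linearZ.
Qed.
HB.instance Definition _ :=
  GRing.isScalable.Build K (presented P) A *:%R lift pres_lift_scalable.

Lemma pres_lift_gen i : lift (pgen i) = f i.
Proof. by rewrite pres_lift_class feval_gen. Qed.

End PresentedLift.

Lemma presentation_consistent (K : comNzRingType) (I : choiceType)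
    (r : free_alg K I -> free_alg K I -> Prop) (f : I -> K^o) :
  (forall x y, r x y -> feval f x = feval f y) -> ~ relation_ideal r 1.
Proof.
move=> fr /(feval_ideal fr) /eqP.
by rewrite rmorph1 oner_eq0.
Qed.

(* Strands and generators are numbered from 0: the generator of index i (in the
   braid group or in either algebra) involves the strands [lower i] = i and
   [upper i] = i+1. *)
Definition lower n (i : 'I_n.-1) : 'I_n := widen_ord (leq_pred n) i.

Fact upper_subproof n (i : 'I_n.-1) : (i.+1 < n)%N.
Proof. by rewrite -ltn_predRL ltn_ord. Qed.
Definition upper n (i : 'I_n.-1) : 'I_n := Ordinal (upper_subproof i).

Definition inc_gen n (i : 'I_n.-1) : 'I_n.+1.-1 := widen_ord (leq_pred n) i.
Definition inc_strand n (j : 'I_n) : 'I_n.+1 := widen_ord (leqnSn n) j.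

Section BraidGroup.
Variable n : nat.

(* (i, true) is sigma_i and (i, false) its inverse. *)
Definition letter := ('I_n.-1 * bool)%type.
Definition sig (i : 'I_n.-1) : letter := (i, true).

Inductive braid_eq : seq letter -> seq letter -> Prop :=
| Braid_refl v : braid_eq v v
| Braid_sym v w of braid_eq v w : braid_eq w v
| Braid_trans v w y of braid_eq v w & braid_eq w y : braid_eq v y
| Braid_cat v w v' w' of braid_eq v v' & braid_eq w w' :
    braid_eq (v ++ w) (v' ++ w')
| Braid_cancel i b : braid_eq [:: (i, b); (i, ~~ b)] [::]
| Braid_far (i j : 'I_n.-1) of (i.+1 < j)%N :
    braid_eq [:: sig i; sig j] [:: sig j; sig i]
| Braid_braid (i j : 'I_n.-1) of j = i.+1 :> nat :
    braid_eq [:: sig j; sig i; sig j] [:: sig i; sig j; sig i].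

Definition braid_eqb : rel (seq letter) := fun v w => `[< braid_eq v w >].

Fact braid_eqb_refl : reflexive braid_eqb.
Proof. by move=> v; apply/asboolP/Braid_refl. Qed.
Fact braid_eqb_sym : symmetric braid_eqb.
Proof. by move=> v w; apply/asboolP/asboolP => /Braid_sym. Qed.
Fact braid_eqb_trans : transitive braid_eqb.
Proof.
move=> w v y /asboolP vw /asboolP wy; apply/asboolP; exact: Braid_trans vw wy.
Qed.
Canonical braid_equiv :=
  EquivRel braid_eqb braid_eqb_refl braid_eqb_sym braid_eqb_trans.

Definition braid := {eq_quot braid_equiv}.
HB.instance Definition _ := Choice.on braid.
HB.instance Definition _ := EqQuotient.on braid.

Definition braid_class (w : seq letter) : braid := \pi_braid w.

Fact braid_classP v w : braid_class v = braid_class w <-> braid_eq v w.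
Proof. by split=> [/eqmodP /asboolP //|vw]; apply/eqmodP; exact/asboolP. Qed.

Fact braid_repr w : braid_eq (repr (braid_class w)) w.
Proof. by apply/braid_classP; rewrite /braid_class reprK. Qed.

Definition inv_word (w : seq letter) : seq letter :=
  rev [seq (l.1, ~~ l.2) | l <- w].

Fact inv_word_cat v w : inv_word (v ++ w) = inv_word w ++ inv_word v.
Proof. by rewrite /inv_word map_cat rev_cat. Qed.

Fact inv_wordK : involutive inv_word.
Proof.
move=> w; rewrite /inv_word map_rev revK -map_comp -[RHS]map_id.
by apply: eq_map => -[i b] /=; rewrite negbK.
Qed.

Fact cat_inv_word w : braid_eq (w ++ inv_word w) [::].
Proof.
elim: w => [|[i b] w IHw]; first exact: Braid_refl.
rewrite -cat1s inv_word_cat -catA (catA w).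
apply: Braid_trans (Braid_cancel i b); rewrite -[[:: _; _]]cat1s.
apply: Braid_cat; first exact: Braid_refl.
by rewrite -[X in braid_eq _ X]cat0s; apply: Braid_cat => //; exact: Braid_refl.
Qed.

Fact cat_inv_wordl w : braid_eq (inv_word w ++ w) [::].
Proof. by have := cat_inv_word (inv_word w); rewrite inv_wordK. Qed.

Fact inv_word_eq v w : braid_eq v w -> braid_eq (inv_word v) (inv_word w).
Proof.
move=> vw; rewrite -[inv_word v]cats0.
apply: (@Braid_trans _ (inv_word v ++ (w ++ inv_word w))).
  apply: Braid_cat; first exact: Braid_refl.
  exact/Braid_sym/cat_inv_word.
rewrite catA -[X in braid_eq _ X]cat0s; apply: Braid_cat; last exact: Braid_refl.
apply: (@Braid_trans _ (inv_word v ++ v)).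
  by apply: Braid_cat; [exact: Braid_refl|exact: Braid_sym].
exact: cat_inv_wordl.
Qed.

Definition braid_one := braid_class [::].
Definition braid_mul (a b : braid) := braid_class (repr a ++ repr b).
Definition braid_inv (a : braid) := braid_class (inv_word (repr a)).

Fact class_cat v w :
  braid_mul (braid_class v) (braid_class w) = braid_class (v ++ w).
Proof. by apply/braid_classP/Braid_cat; apply: braid_repr. Qed.
Fact class_inv v : braid_inv (braid_class v) = braid_class (inv_word v).
Proof. by apply/braid_classP/inv_word_eq/braid_repr. Qed.

Fact braidW (Q : braid -> Prop) :
  (forall w, Q (braid_class w)) -> forall a, Q a.
Proof. by move=> h a; rewrite -[a]reprK; apply: h. Qed.

Fact braid_mulA : associative braid_mul.
Proof.
by elim/braidW => v; elim/braidW => w; elim/braidW => y; rewrite !class_cat catA.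
Qed.
Fact braid_mul1l : left_id braid_one braid_mul.
Proof. by elim/braidW => v; rewrite class_cat. Qed.
Fact braid_mul1r : right_id braid_one braid_mul.
Proof. by elim/braidW => v; rewrite class_cat cats0. Qed.
Fact braid_mulV : right_inverse braid_one braid_inv braid_mul.
Proof.
elim/braidW => v; rewrite class_inv class_cat.
exact/braid_classP/cat_inv_word.
Qed.
Fact braid_mulVl : left_inverse braid_one braid_inv braid_mul.
Proof.
elim/braidW => v; rewrite class_inv class_cat.
exact/braid_classP/cat_inv_wordl.
Qed.
HB.instance Definition _ := isGroup.Build braid
  braid_mulA braid_mul1l braid_mul1r braid_mulVl braid_mulV.

Definition sigma (i : 'I_n.-1) : braid := braid_class [:: sig i].

Definition word_writhe (w : seq letter) : int :=
  \sum_(l <- w) (if l.2 then 1 else - 1).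

Definition writhe (a : braid) : int := word_writhe (repr a).

Lemma word_writhe_eq v w : braid_eq v w -> word_writhe v = word_writhe w.
Proof.
elim=> {v w} //= [v w y _ -> _ -> //|v w v' w' _ vE _ wE|i b|i j _|i j _].
- by rewrite /word_writhe !big_cat /=; congr (_ + _).
- by rewrite /word_writhe !big_cons big_nil; case: b.
- by rewrite /word_writhe !big_cons big_nil.
- by rewrite /word_writhe !big_cons big_nil.
Qed.

Lemma writheE w : writhe (braid_class w) = word_writhe w.
Proof. exact/word_writhe_eq/braid_repr. Qed.

Section BraidMap.
Variables (A : pzRingType) (f f' : 'I_n.-1 -> A).

Definition word_map (w : seq letter) : A :=
  \prod_(l <- w) (if l.2 then f l.1 else f' l.1).

(* The multiplicative map sending sigma_i to f i and its inverse to f' i; it is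
   well defined under the hypotheses below. *)
Definition braid_map (a : braid) : A := word_map (repr a).

Hypothesis fV : forall i, f i * f' i = 1.
Hypothesis Vf : forall i, f' i * f i = 1.
Hypothesis f_far : forall i j : 'I_n.-1, (i.+1 < j)%N -> f i * f j = f j * f i.
Hypothesis f_braid : forall i j : 'I_n.-1,
  j = i.+1 :> nat -> f j * f i * f j = f i * f j * f i.

Lemma word_map_eq v w : braid_eq v w -> word_map v = word_map w.
Proof.
elim=> {v w} //= [v w y _ -> _ -> //|v w v' w' _ vE _ wE|i b|i j ij|i j ij].
- by rewrite /word_map !big_cat /=; congr (_ * _).
- by rewrite /word_map !big_cons big_nil mulr1; case: b => /=.
- by rewrite /word_map !big_cons big_nil !mulr1; apply: f_far.
- by rewrite /word_map !big_cons big_nil !mulr1 !mulrA; apply: f_braid.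
Qed.

Lemma braid_mapE w : braid_map (braid_class w) = word_map w.
Proof. exact/word_map_eq/braid_repr. Qed.

Lemma braid_mapM a b : braid_map (a * b)%g = braid_map a * braid_map b.
Proof.
elim/braidW: a => v; elim/braidW: b => w.
have -> : (braid_class v * braid_class w)%g = braid_class (v ++ w).
  exact: class_cat.
by rewrite !braid_mapE /word_map big_cat.
Qed.

Lemma braid_map1 : braid_map 1%g = 1.
Proof.
have -> : 1%g = braid_class [::] by [].
by rewrite braid_mapE /word_map big_nil.
Qed.

Lemma braid_map_sigma i : braid_map (sigma i) = f i.
Proof. by rewrite braid_mapE /word_map big_seq1. Qed.

End BraidMap.
End BraidGroup.

Section Links.

Definition inc_word n (w : seq (letter n)) : seq (letter n.+1) :=
  [seq (inc_gen l.1, l.2) | l <- w].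

Definition braid_inc n (a : braid n) : braid n.+1 :=
  braid_class (inc_word (repr a)).

Fact inc_word_eq n (v w : seq (letter n)) :
  braid_eq v w -> braid_eq (inc_word v) (inc_word w).
Proof.
elim=> {v w}.
- by move=> v; apply: Braid_refl.
- by move=> v w _; apply: Braid_sym.
- by move=> v w y _ vw _; apply: Braid_trans vw.
- by move=> v w v' w' _ vE _ wE; rewrite /inc_word !map_cat; apply: Braid_cat.
- by move=> i b; apply: Braid_cancel.
- by move=> i j ij; apply: Braid_far.
- by move=> i j ij; apply: Braid_braid.
Qed.

Lemma braid_incE n (w : seq (letter n)) :
  braid_inc (braid_class w) = braid_class (inc_word w).
Proof. exact/braid_classP/inc_word_eq/braid_repr. Qed.

(* Pairs (n, a) with a a braid on n+1 strands. *)
Definition any_braid := {n : nat & braid n.+1}.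
Definition any n (a : braid n.+1) : any_braid := Tagged (fun n => braid n.+1) a.

Inductive markov : any_braid -> any_braid -> Prop :=
| Markov_refl s : markov s s
| Markov_sym s t of markov s t : markov t s
| Markov_trans s t r of markov s t & markov t r : markov s r
| Markov_conj n (a b : braid n.+1) : markov (any (a * b)%g) (any (b * a)%g)
| Markov_stab n (a : braid n.+1) :
    markov (any (braid_inc a * @sigma n.+2 ord_max)%g) (any a)
| Markov_stabV n (a : braid n.+1) :
    markov (any (braid_inc a * (@sigma n.+2 ord_max)^-1)%g) (any a).

Definition markovb : rel any_braid := fun s t => `[< markov s t >].

Fact markovb_refl : reflexive markovb.
Proof. by move=> s; apply/asboolP/Markov_refl. Qed.
Fact markovb_sym : symmetric markovb.
Proof. by move=> s t; apply/asboolP/asboolP => /Markov_sym. Qed.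
Fact markovb_trans : transitive markovb.
Proof.
move=> t s r /asboolP st /asboolP tr; apply/asboolP; exact: Markov_trans st tr.
Qed.
Canonical markov_equiv := EquivRel markovb markovb_refl markovb_sym markovb_trans.

(* By the theorems of Alexander and Markov, closing braids identifies the set
   of isotopy classes of (non-empty) oriented links in S^3 with the set of
   braids on any number of strands up to conjugation and stabilisation. *)
Definition oriented_link := {eq_quot markov_equiv}.

Definition braid_closure n (a : braid n.+1) : oriented_link := \pi_oriented_link (any a).

End Links.

Section IwahoriHecke.
Variables (K : fieldType) (q : K).

Section Presentation.
Variable n : nat.
Local Notation F := (free_alg K 'I_n.-1).
Local Notation X := (@fgen K 'I_n.-1).

Inductive hecke_rel : F -> F -> Prop :=
| Hecke_far (i j : 'I_n.-1) of (i.+1 < j)%N : hecke_rel (X i * X j) (X j * X i)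
| Hecke_braid (i j : 'I_n.-1) of j = i.+1 :> nat :
    hecke_rel (X j * X i * X j) (X i * X j * X i)
| Hecke_quad (i : 'I_n.-1) : hecke_rel (X i ^+ 2) ((q - 1) *: X i + q%:A).

Fact hecke_consistent : ~ relation_ideal hecke_rel 1.
Proof.
apply: (@presentation_consistent _ _ _ (fun=> -1)) => x y.
case=> [i j _|i j _|i].
- by rewrite !rmorphM /= !feval_gen.
- by rewrite !rmorphM /= !feval_gen.
rewrite rmorphXn rmorphD /= !fevalZ rmorph1 feval_gen.
rewrite sqrrN expr1n /GRing.scale /= mulrN1 mulr1.
by rewrite opprB subrK.
Qed.

Definition hecke_pres := Presentation hecke_consistent.
Definition hecke : algType K := presented hecke_pres.
Definition hG (i : 'I_n.-1) : hecke := @pgen K hecke_pres i.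

Lemma hG_far (i j : 'I_n.-1) : (i.+1 < j)%N -> hG i * hG j = hG j * hG i.
Proof.
move=> ij; rewrite /hG /pgen -!pclassM; apply: pres_relE.
exact: Hecke_far.
Qed.

Lemma hG_braid (i j : 'I_n.-1) :
  j = i.+1 :> nat -> hG j * hG i * hG j = hG i * hG j * hG i.
Proof.
move=> ij; rewrite /hG /pgen -!pclassM; apply: pres_relE.
exact: Hecke_braid.
Qed.

Lemma hG_quad i : hG i ^+ 2 = (q - 1) *: hG i + q%:A.
Proof.
rewrite /hG /pgen -pclassX (@pres_relE K hecke_pres _ _ (Hecke_quad i)).
by rewrite pclassD !pclassZ pclass1.
Qed.

Section Lift.
Variables (A : algType K) (f : 'I_n.-1 -> A).
Hypothesis f_far : forall i j : 'I_n.-1, (i.+1 < j)%N -> f i * f j = f j * f i.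
Hypothesis f_braid : forall i j : 'I_n.-1,
  j = i.+1 :> nat -> f j * f i * f j = f i * f j * f i.
Hypothesis f_quad : forall i, f i ^+ 2 = (q - 1) *: f i + q%:A.

Fact hecke_lift_subproof x y :
  @pres_rel K hecke_pres x y -> feval f x = feval f y.
Proof.
case=> [i j ij|i j ij|i].
- by rewrite !rmorphM /= !feval_gen; apply: f_far.
- by rewrite !rmorphM /= !feval_gen; apply: f_braid.
by rewrite rmorphXn rmorphD /= !fevalZ rmorph1 feval_gen; apply: f_quad.
Qed.

Definition hecke_lift : {lrmorphism hecke -> A} := pres_lift hecke_lift_subproof.

Lemma hecke_lift_gen i : hecke_lift (hG i) = f i.
Proof. exact: (pres_lift_gen hecke_lift_subproof). Qed.

End Lift.

Definition hGV (i : 'I_n.-1) : hecke := q^-1 *: (hG i - (q - 1)%:A).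

Lemma hGK i : q != 0 -> hG i * hGV i = 1.
Proof.
move=> q0; rewrite /hGV -scalerAr mulrBr -expr2 hG_quad mulr_algr.
by rewrite addrAC subrr add0r scalerA mulVf // scale1r.
Qed.

Lemma hGVK i : q != 0 -> hGV i * hG i = 1.
Proof.
move=> q0; rewrite /hGV -scalerAl mulrBl -expr2 hG_quad mulr_algl.
by rewrite addrAC subrr add0r scalerA mulVf // scale1r.
Qed.

(* The homomorphism CB_n -> H_n(q), sigma_i |-> G_i, restricted to B_n. *)
Definition hecke_rep : braid n -> hecke := braid_map hG hGV.

Lemma hecke_rep_sigma i : q != 0 -> hecke_rep (sigma i) = hG i.
Proof.
move=> q0; apply: braid_map_sigma => *; [exact: hGK|exact: hGVK| |].
  exact: hG_far.
exact: hG_braid.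
Qed.

Lemma hecke_repM a b :
  q != 0 -> hecke_rep (a * b)%g = hecke_rep a * hecke_rep b.
Proof.
move=> q0; apply: braid_mapM => *; [exact: hGK|exact: hGVK| |].
  exact: hG_far.
exact: hG_braid.
Qed.

End Presentation.

Definition hecke_inc n : {lrmorphism hecke n -> hecke n.+1} :=
  @hecke_lift n (hecke n.+1) (fun i => @hG n.+1 (inc_gen i))
    (fun i j => @hG_far n.+1 (inc_gen i) (inc_gen j))
    (fun i j => @hG_braid n.+1 (inc_gen i) (inc_gen j))
    (fun i => @hG_quad n.+1 (inc_gen i)).

Lemma hecke_inc_gen n (i : 'I_n.-1) : hecke_inc n (hG i) = hG (inc_gen i).
Proof. exact: hecke_lift_gen. Qed.

End IwahoriHecke.

(* The element e_i = (1/d) sum_s t_i^s t_(i+1)^(-s), where t^(-s) is written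
   t^(d-s) because t^d = 1. *)
Definition idem_e (K : fieldType) (d n : nat) (A : algType K) (t : 'I_n -> A)
    (i : 'I_n.-1) : A :=
  d%:R^-1 *: \sum_(s < d) t (lower i) ^+ s * t (upper i) ^+ (d - s).

Lemma idem_e_morph (K : fieldType) (d n : nat) (A B : algType K)
    (phi : {lrmorphism A -> B}) (t : 'I_n -> A) i :
  phi (idem_e d t i) = idem_e d (phi \o t) i.
Proof.
rewrite linearZ raddf_sum /=; congr (_ *: _); apply: eq_bigr => s _ /=.
by rewrite rmorphM !rmorphXn.
Qed.

Lemma eq_idem_e (K : fieldType) (d n : nat) (A : algType K)
    (t t' : 'I_n -> A) i : t =1 t' -> idem_e d t i = idem_e d t' i.
Proof. by move=> tE; congr (_ *: _); apply: eq_bigr => s _; rewrite !tE. Qed.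

Section YokonumaHecke.
Variables (K : fieldType) (d : nat) (u : K).

Section Presentation.
Variable n : nat.
Local Notation I := ('I_n.-1 + 'I_n)%type.
Local Notation F := (free_alg K I).
Local Notation Xg i := (@fgen K I (inl i)).
Local Notation Xt j := (@fgen K I (inr j)).
Local Notation Xe i := (idem_e d (fun j => Xt j) i).

Inductive yokonuma_rel : F -> F -> Prop :=
| Yokonuma_far (i j : 'I_n.-1) of (i.+1 < j)%N :
    yokonuma_rel (Xg i * Xg j) (Xg j * Xg i)
| Yokonuma_braid (i j : 'I_n.-1) of j = i.+1 :> nat :
    yokonuma_rel (Xg j * Xg i * Xg j) (Xg i * Xg j * Xg i)
| Yokonuma_tt (j k : 'I_n) : yokonuma_rel (Xt j * Xt k) (Xt k * Xt j)
| Yokonuma_tg (j : 'I_n) (i : 'I_n.-1) :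
    yokonuma_rel (Xt j * Xg i) (Xg i * Xt (tperm (lower i) (upper i) j))
| Yokonuma_td (j : 'I_n) : yokonuma_rel (Xt j ^+ d) 1
| Yokonuma_quad (i : 'I_n.-1) :
    yokonuma_rel (Xg i ^+ 2) (1 + (u - 1) *: Xe i + (u - 1) *: (Xe i * Xg i)).

Section Eval.
Variables (A : algType K) (g : 'I_n.-1 -> A) (t : 'I_n -> A).
Definition yokonuma_gens (x : I) : A :=
  match x with inl i => g i | inr j => t j end.

Hypothesis g_far : forall i j : 'I_n.-1, (i.+1 < j)%N -> g i * g j = g j * g i.
Hypothesis g_braid : forall i j : 'I_n.-1,
  j = i.+1 :> nat -> g j * g i * g j = g i * g j * g i.
Hypothesis t_comm : forall j k, t j * t k = t k * t j.
Hypothesis t_g : forall j i,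
  t j * g i = g i * t (tperm (lower i) (upper i) j).
Hypothesis t_d : forall j, t j ^+ d = 1.
Hypothesis g_quad : forall i,
  g i ^+ 2 = 1 + (u - 1) *: idem_e d t i + (u - 1) *: (idem_e d t i * g i).

Fact feval_e i : feval yokonuma_gens (Xe i) = idem_e d t i.
Proof.
by rewrite idem_e_morph; apply: eq_idem_e => j /=; rewrite feval_gen.
Qed.

Fact yokonuma_eval x y :
  yokonuma_rel x y -> feval yokonuma_gens x = feval yokonuma_gens y.
Proof.
case=> [i j ij|i j ij|j k|j i|j|i].
- by rewrite !rmorphM /= !feval_gen; apply: g_far.
- by rewrite !rmorphM /= !feval_gen; apply: g_braid.
- by rewrite !rmorphM /= !feval_gen; apply: t_comm.
- by rewrite !rmorphM /= !feval_gen; apply: t_g.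
- by rewrite rmorphXn rmorph1 /= feval_gen; apply: t_d.
have eE := feval_e i; move: (Xe i) eE => e eE.
rewrite rmorphXn !rmorphD rmorph1 /= !fevalZ rmorphM /= eE !feval_gen.
exact: g_quad.
Qed.
End Eval.

Fact yokonuma_consistent : ~ relation_ideal yokonuma_rel 1.
Proof.
apply: (@presentation_consistent _ _ _
  (@yokonuma_gens K^o (fun=> -1) (fun=> 1))) => x y.
apply: yokonuma_eval => // [j i|j|i].
- by rewrite mulr1 mul1r.
- by rewrite expr1n.
by rewrite mulrN1 scalerN addrK sqrrN expr1n.
Qed.

Definition yokonuma_pres := Presentation yokonuma_consistent.
Definition yokonuma : algType K := presented yokonuma_pres.
Definition yg (i : 'I_n.-1) : yokonuma := @pgen K yokonuma_pres (inl i).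
Definition yt (j : 'I_n) : yokonuma := @pgen K yokonuma_pres (inr j).
Definition ye (i : 'I_n.-1) : yokonuma := idem_e d yt i.

Lemma yg_far (i j : 'I_n.-1) : (i.+1 < j)%N -> yg i * yg j = yg j * yg i.
Proof.
move=> ij; rewrite /yg /pgen -!pclassM; apply: pres_relE.
exact: Yokonuma_far.
Qed.

Lemma yg_braid (i j : 'I_n.-1) :
  j = i.+1 :> nat -> yg j * yg i * yg j = yg i * yg j * yg i.
Proof.
move=> ij; rewrite /yg /pgen -!pclassM; apply: pres_relE.
exact: Yokonuma_braid.
Qed.

Lemma yt_comm j k : yt j * yt k = yt k * yt j.
Proof.
rewrite /yt /pgen -!pclassM; apply: pres_relE; exact: Yokonuma_tt.
Qed.

Lemma yt_yg j i : yt j * yg i = yg i * yt (tperm (lower i) (upper i) j).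
Proof.
rewrite /yt /yg /pgen -!pclassM; apply: pres_relE; exact: Yokonuma_tg.
Qed.

Lemma yt_d j : yt j ^+ d = 1.
Proof.
rewrite /yt /pgen -pclassX -pclass1; apply: pres_relE; exact: Yokonuma_td.
Qed.

Lemma yg_quad i :
  yg i ^+ 2 = 1 + (u - 1) *: ye i + (u - 1) *: (ye i * yg i).
Proof.
have -> : ye i = pres_class (P := yokonuma_pres) (Xe i).
  by rewrite (idem_e_morph d (pres_class (P := yokonuma_pres))).
have := @pres_relE K yokonuma_pres _ _ (Yokonuma_quad i).
move: (Xe i) => e; rewrite pclassX => ->.
by rewrite !pclassD !pclassZ pclassM pclass1.
Qed.

Definition yokonuma_lift (A : algType K) (g : 'I_n.-1 -> A) (t : 'I_n -> A)
    g_far g_braid t_comm t_g t_d g_quad : {lrmorphism yokonuma -> A} :=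
  pres_lift (P := yokonuma_pres)
    (@yokonuma_eval A g t g_far g_braid t_comm t_g t_d g_quad).

Lemma yokonuma_lift_g (A : algType K) (g : 'I_n.-1 -> A) (t : 'I_n -> A)
    h1 h2 h3 h4 h5 h6 i :
  @yokonuma_lift A g t h1 h2 h3 h4 h5 h6 (yg i) = g i.
Proof. exact: pres_lift_gen. Qed.

Lemma yokonuma_lift_t (A : algType K) (g : 'I_n.-1 -> A) (t : 'I_n -> A)
    h1 h2 h3 h4 h5 h6 j :
  @yokonuma_lift A g t h1 h2 h3 h4 h5 h6 (yt j) = t j.
Proof. exact: pres_lift_gen. Qed.

Lemma yt_exp_comm j k a b : yt j ^+ a * yt k ^+ b = yt k ^+ b * yt j ^+ a.
Proof. by apply: commrX; apply/commr_sym; apply: commrX; apply: yt_comm. Qed.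

Lemma yt_exp1 j k a : yt j ^+ a * yt k = yt k * yt j ^+ a.
Proof. by apply/commr_sym; apply: commrX; apply: yt_comm. Qed.

Lemma yt_exp_yg j i a :
  yt j ^+ a * yg i = yg i * yt (tperm (lower i) (upper i) j) ^+ a.
Proof.
elim: a => [|a IHa]; first by rewrite !expr0 mul1r mulr1.
by rewrite exprS -mulrA IHa mulrA yt_yg -mulrA -exprS.
Qed.

Lemma ye_yg i : ye i * yg i = yg i * ye i.
Proof.
rewrite /ye /idem_e -scalerAl -scalerAr mulr_suml mulr_sumr; congr (_ *: _).
have yE (s : 'I_d) : yt (lower i) ^+ s * yt (upper i) ^+ (d - s) * yg i =
    yg i * (yt (lower i) ^+ (d - s) * yt (upper i) ^+ s).
  by rewrite -mulrA yt_exp_yg mulrA yt_exp_yg tpermL tpermR -mulrA yt_exp_comm.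
under eq_bigr do rewrite yE.
rewrite -!mulr_sumr; congr (_ * _).
rewrite -(big_mkord xpredT (fun s => yt (lower i) ^+ (d - s) * yt (upper i) ^+ s)).
rewrite -(big_mkord xpredT (fun s => yt (lower i) ^+ s * yt (upper i) ^+ (d - s))).
case: d yt_d => [|e] td; first by rewrite !big_nil.
rewrite big_nat_recl // [RHS]big_nat_recl // !subn0 !expr0 !td; congr (_ + _).
rewrite big_nat_rev /= add0n; apply: eq_big_nat => s /= se.
have -> : (e.+1 - (e - s.+1).+1 = s.+1)%N by lia.
by have -> : ((e - s.+1).+1 = e.+1 - s.+1)%N by lia.
Qed.

Definition ygV (i : 'I_n.-1) : yokonuma :=
  yg i + (u^-1 - 1) *: (ye i + ye i * yg i).

(* The homomorphism CB_n -> Y_(d,n)(u), sigma_i |-> g_i, restricted to B_n. *)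
Definition yokonuma_rep : braid n -> yokonuma := braid_map yg ygV.

End Presentation.

Fact inc_strand_tperm n (i : 'I_n.-1) (j : 'I_n) :
  inc_strand (tperm (lower i) (upper i) j)
  = tperm (lower (inc_gen i)) (upper (inc_gen i))
      (inc_strand j).
Proof.
have inj : injective (@inc_strand n) by move=> k l /(congr1 val) kl; apply: val_inj.
have -> : lower (inc_gen i) = inc_strand (lower i) by exact/val_inj.
have -> : upper (inc_gen i) = inc_strand (upper i) by exact/val_inj.
by case: (tpermP (lower i) (upper i) j) => [->|->|jl ju];
  rewrite ?tpermL ?tpermR // tpermD // (inj_eq inj) eq_sym; apply/eqP.
Qed.

Fact ye_inc n (i : 'I_n.-1) :
  ye (inc_gen i) = idem_e d (fun j => yt (inc_strand j)) i.
Proof.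
rewrite /ye /idem_e; congr (_ *: _); apply: eq_bigr => s _.
by congr (yt _ ^+ _ * yt _ ^+ _); apply: val_inj.
Qed.

Definition yokonuma_inc n : {lrmorphism yokonuma n -> yokonuma n.+1}.
Proof.
apply: (@yokonuma_lift n (yokonuma n.+1) (fun i => @yg n.+1 (inc_gen i))
         (fun j => @yt n.+1 (inc_strand j))).
- by move=> i j ij; apply: yg_far.
- by move=> i j ij; apply: yg_braid.
- by move=> j k; apply: yt_comm.
- by move=> j i; rewrite yt_yg inc_strand_tperm.
- by move=> j; apply: yt_d.
by move=> i; rewrite -ye_inc yg_quad.
Defined.

Lemma yokonuma_inc_g n i : yokonuma_inc n (yg i) = yg (inc_gen i).
Proof. exact: yokonuma_lift_g. Qed.

Lemma yokonuma_inc_t n j : yokonuma_inc n (yt j) = yt (inc_strand j).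
Proof. exact: yokonuma_lift_t. Qed.

End YokonumaHecke.

Section YokonumaRep.
Variables (K : numFieldType) (d : nat) (u : K) (n : nat).
Local Notation Y := (yokonuma d u n).
Local Notation ye := (@ye K d u n).
Local Notation yt := (@yt K d u n).
Local Notation yg := (@yg K d u n).
Local Notation ygV := (@ygV K d u n).

Lemma ye_yt i : ye i * yt (lower i) = ye i * yt (upper i).
Proof.
rewrite /Defs.ye /idem_e -!scalerAl !mulr_suml; congr (_ *: _).
have lE (s : 'I_d) : yt (lower i) ^+ s * yt (upper i) ^+ (d - s) * yt (lower i)
    = yt (lower i) ^+ s.+1 * yt (upper i) ^+ (d - s).
  by rewrite -mulrA yt_exp1 mulrA -exprSr.
have uE (s : 'I_d) : yt (lower i) ^+ s * yt (upper i) ^+ (d - s) * yt (upper i)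
    = yt (lower i) ^+ s * yt (upper i) ^+ (d - s).+1.
  by rewrite -mulrA -exprSr.
rewrite (eq_bigr _ (fun s _ => lE s)) (eq_bigr _ (fun s _ => uE s)).
pose F s := yt (lower i) ^+ s * yt (upper i) ^+ (d.+1 - s).
rewrite (eq_bigr (fun s : 'I_d => F s.+1)); last first.
  by move=> s _; rewrite /F subSS.
rewrite [RHS](eq_bigr (fun s : 'I_d => F s)); last first.
  by move=> s _; rewrite /F subSn // ltnW.
apply: (@addrI _ (F 0%N)).
rewrite -(big_ord_recl d (fun s : 'I_d.+1 => F s)) big_ord_recr /= addrC.
congr (_ + _).
by rewrite /F subSnn expr1 yt_d mul1r subn0 expr0 mul1r exprS yt_d mulr1.
Qed.

Lemma ye_idem i : ye i * ye i = ye i.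
Proof.
have lX a : ye i * yt (lower i) ^+ a = ye i * yt (upper i) ^+ a.
  elim: a => [|a IHa]; first by rewrite !expr0.
  rewrite exprSr mulrA IHa -mulrA yt_exp1.
  by rewrite mulrA ye_yt -mulrA -exprS.
rewrite [X in _ * X]/Defs.ye /idem_e -scalerAr mulr_sumr.
rewrite (eq_bigr (fun=> ye i)); last first.
  move=> s _; rewrite mulrA lX -mulrA -exprD subnKC ?yt_d ?mulr1 //.
  exact/ltnW/ltn_ord.
rewrite sumr_const card_ord -scaler_nat scalerA.
have [d0|d0] := eqVneq d 0%N.
  by rewrite /Defs.ye /idem_e d0 big_ord0 !scaler0.
by rewrite mulVf ?pnatr_eq0 // scale1r.
Qed.

Lemma ye_yg_quad i : ye i * yg i ^+ 2 = u *: ye i + (u - 1) *: (ye i * yg i).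
Proof.
rewrite yg_quad !mulrDr mulr1 -!(scalerAr (u - 1)) mulrA !ye_idem; congr (_ + _).
by rewrite -{1}[ye i]scale1r -scalerDl addrC subrK.
Qed.

Fact yg_inv_sum (M : lmodType K) (e V : M) : u != 0 ->
  (u - 1) *: e + (u - 1) *: V
  + (u^-1 - 1) *: (V + (u *: e + (u - 1) *: V)) = 0.
Proof.
move=> u0; have cu : (u^-1 - 1) * u = 1 - u by rewrite mulrBl mulVf // mul1r.
have -> : V + (u *: e + (u - 1) *: V) = u *: (e + V).
  by rewrite addrCA -{1}[V]scale1r -scalerDl [1 + _]addrC subrK scalerDr.
by rewrite scalerA cu -scalerDr -scalerDl -[1 - u]opprB subrr scale0r.
Qed.

Lemma ygK i : u != 0 -> yg i * ygV i = 1.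
Proof.
move=> u0; rewrite /Defs.ygV mulrDr -(scalerAr (u^-1 - 1)) mulrDr -ye_yg mulrA -ye_yg -mulrA.
rewrite -expr2 ye_yg_quad yg_quad -!addrA [X in _ + X]addrA.
by rewrite yg_inv_sum // addr0.
Qed.

Lemma ygVK i : u != 0 -> ygV i * yg i = 1.
Proof.
move=> u0; rewrite /Defs.ygV mulrDl -(scalerAl (u^-1 - 1)) mulrDl -mulrA.
rewrite -expr2 ye_yg_quad yg_quad -!addrA [X in _ + X]addrA.
by rewrite yg_inv_sum // addr0.
Qed.

Lemma yokonuma_rep_sigma i : u != 0 -> yokonuma_rep d u (sigma i) = yg i.
Proof.
move=> u0; apply: braid_map_sigma => *; [exact: ygK|exact: ygVK| |].
  exact: yg_far.
exact: yg_braid.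
Qed.

Lemma yokonuma_repM a b : u != 0 ->
  yokonuma_rep d u (a * b)%g = yokonuma_rep d u a * yokonuma_rep d u b :> Y.
Proof.
move=> u0; apply: braid_mapM => *; [exact: ygK|exact: ygVK| |].
  exact: yg_far.
exact: yg_braid.
Qed.

End YokonumaRep.

Section Traces.
Variable K : numFieldType.

Definition ocneanu_trace (q zeta : K) (tau : forall n, {scalar hecke q n}) :
    Prop :=
  [/\ tau 0%N 1 = 1,
      forall n (h : hecke q n), tau n.+1 (hecke_inc q n h) = tau n h,
      forall n (h h' : hecke q n), tau n (h * h') = tau n (h' * h)
    & forall n (h : hecke q n.+1),
        tau n.+2 (hecke_inc q n.+1 h * @hG _ q n.+2 ord_max) =
        zeta * tau n.+1 h].

(* The family x_1, ..., x_(d-1) extended to all indices by reduction modulo d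
   and the convention x_0 = 1; only x 1, ..., x d.-1 matter. *)
Definition xmod (d : nat) (x : nat -> K) (k : nat) : K :=
  if (k %% d == 0)%N then 1 else x (k %% d)%N.

Definition E_system (d : nat) (x : nat -> K) : Prop :=
  forall m, (0 < m < d)%N ->
    \sum_(s < d) xmod d x (m + s) * xmod d x (d - s) =
    xmod d x m * \sum_(s < d) xmod d x s * xmod d x (d - s).

Definition juyumaya_trace (d : nat) (u z : K) (x : nat -> K)
    (tr : forall n, {scalar yokonuma d u n}) : Prop :=
  [/\ tr 0%N 1 = 1,
      forall n (a : yokonuma d u n), tr n.+1 (yokonuma_inc d u n a) = tr n a,
      forall n (a b : yokonuma d u n), tr n (a * b) = tr n (b * a),
      forall n (a : yokonuma d u n.+1),
        tr n.+2 (yokonuma_inc d u n.+1 a * @yg _ d u n.+2 ord_max) =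
        z * tr n.+1 a
    & forall n (a : yokonuma d u n) m, (0 < m < d)%N ->
        tr n.+1 (yokonuma_inc d u n a * @yt _ d u n.+1 ord_max ^+ m) =
        x m * tr n a].

(* tr(e_1), computed in Y_(d,2) *)
Definition trace_e (d : nat) (u : K) (tr : forall n, {scalar yokonuma d u n}) :
    K :=
  tr 2 (@ye _ d u 2 ord0).

Definition lambdaH (q zeta : K) : K := (zeta + (1 - q)) / (q * zeta).
Definition lambdaY (u z E : K) : K := (z + (1 - u) * E) / (u * z).

(* Below, s is the chosen square root of lambda. *)
Definition homflypt_value (q zeta s : K) (tau : forall n, {scalar hecke q n})
    n (a : braid n.+1) : K :=
  (1 / (zeta * s)) ^+ n * s ^ writhe a * tau n.+1 (hecke_rep q a).

Definition delta_value (d : nat) (u z s : K)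
    (tr : forall n, {scalar yokonuma d u n}) n (a : braid n.+1) : K :=
  (1 / (z * s)) ^+ n * s ^ writhe a * tr n.+1 (yokonuma_rep d u a).

End Traces.

(* Main.v *)
(** Both invariants are determined by Markov traces, and the trace property of
    Juyumaya's trace is exploited modulo the elements [y_i = e_i (1 + g_i)], for
    which [g_i^2 = 1 + (u - 1) y_i] and [g_i y_i = u y_i].

    Sufficiency.  If [u = 1], or [z = - E] (then [tr (a y_i) = 0] for all [a]), or
    [E = 1] (then the x_m are multiplicative and [tr (a e_i) = tr a]), the [c g_i]
    satisfy under the trace a quadratic Hecke relation, so [tr] composed with
    [G_i |-> c g_i] is an Ocneanu trace, and Ocneanu traces are unique.  In the
    cases [zeta = q] and [zeta = - 1] both traces are characters on braids.

    Necessity.  The two-component unlink gives [zeta sH = z sY], so that [tr]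
    satisfies the skein relation of [tau] up to rescaling.  Applied to the braids
    1, s1, s1^2 and s2 s1^2 s2, it yields four polynomial equations whose
    solutions, with [E <> - 1], are the listed ones. *)
Require Import Defs.
From HB Require Import structures.
From mathcomp Require Import all_boot all_order all_algebra perm.
From mathcomp Require Import zify ring.
From mathcomp Require Import reals.
From mathcomp Require Import complex.

Set Implicit Arguments.
Unset Strict Implicit.
Unset Printing Implicit Defensive.

Import Order.TTheory GRing.Theory Num.Theory.
Local Open Scope ring_scope.

(** * Commutation in the tower of Yokonuma-Hecke algebras *)

Lemma yokonuma_ind (K : fieldType) (d : nat) (u : K) n
    (Q : yokonuma d u n -> Prop) :
  Q 1 -> (forall i, Q (yg d u i)) -> (forall j, Q (yt d u j)) ->
  (forall x y, Q x -> Q y -> Q (x + y)) -> (forall k x, Q x -> Q (k *: x)) ->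
  (forall x y, Q x -> Q y -> Q (x * y)) -> forall x, Q x.
Proof. by move=> Q1 Qg Qt QD QZ QM; apply: presented_ind => // -[]. Qed.

Lemma ord_lift_or_last n (i : 'I_n.+1) :
  (exists j : 'I_n, i = inc_strand j) \/ i = ord_max.
Proof.
have [lin|] := ltnP i n; first by left; exists (Ordinal lin); exact: val_inj.
by move=> lni; right; apply/val_inj/anti_leq; rewrite lni -ltnS ltn_ord.
Qed.

Section YokonumaTower.
Variables (K : fieldType) (d : nat) (u : K).
Local Notation Y := (yokonuma d u).
Local Notation inc := (yokonuma_inc d u _).
Local Notation g := (yg d u).
Local Notation t := (yt d u).
Local Notation e := (ye d u).

(* Specialised to [inc]: with the generic rmorphism lemmas, [/=] would unfold
   [yokonuma_inc]. *)
Lemma yokonuma_incM n (x y : Y n) : inc (x * y) = inc x * inc y.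
Proof. exact: rmorphM. Qed.

Lemma yokonuma_incD n (x y : Y n) : inc (x + y) = inc x + inc y.
Proof. exact: rmorphD. Qed.

Lemma yokonuma_incZ n k (x : Y n) : inc (k *: x) = k *: inc x.
Proof. exact: linearZ. Qed.

Lemma yokonuma_inc1 n : inc (1 : Y n) = 1.
Proof. exact: rmorph1. Qed.

Lemma yokonuma_inc_tX n (j : 'I_n) k : inc (t j ^+ k) = t (inc_strand j) ^+ k.
Proof.
elim: k => [|k IHk]; first by rewrite !expr0 yokonuma_inc1.
by rewrite !exprS yokonuma_incM IHk yokonuma_inc_t.
Qed.

Lemma yokonuma_inc_e n (i : 'I_n.-1) : inc (e i) = e (inc_gen i).
Proof.
rewrite ye_inc idem_e_morph; apply: eq_idem_e => j /=.
exact: yokonuma_inc_t.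
Qed.

(** The transpositions attached to the generators of the smaller algebra fix the last strand. *)
Lemma yt_max_inc n (a : Y n) k : t ord_max ^+ k * inc a = inc a * t ord_max ^+ k.
Proof.
elim/yokonuma_ind: a => [|i|j|x y Qx Qy|c x Qx|x y Qx Qy].
- by rewrite yokonuma_inc1 mulr1 mul1r.
- rewrite yokonuma_inc_g yt_exp_yg tpermD //.
    by apply/eqP => /(congr1 val) /= h; have := ltn_ord i; lia.
  by apply/eqP => /(congr1 val) /= h; have := ltn_ord i; lia.
- by rewrite yokonuma_inc_t yt_exp1.
- by rewrite yokonuma_incD mulrDr mulrDl Qx Qy.
- by rewrite yokonuma_incZ -scalerAl -scalerAr Qx.
- by rewrite yokonuma_incM mulrA Qx -!mulrA Qy.
Qed.

Lemma yg_max_inc2 n (i : 'I_n.+1) (a : Y n) :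
  i = n :> nat -> g (i : 'I_n.+2.-1) * inc (inc a) = inc (inc a) * g (i : 'I_n.+2.-1).
Proof.
move=> iE; elim/yokonuma_ind: a => [|j|j|x y Qx Qy|c x Qx|x y Qx Qy].
- by rewrite !yokonuma_inc1 mulr1 mul1r.
- by rewrite !yokonuma_inc_g [RHS]yg_far //=; have := ltn_ord j; lia.
- rewrite !yokonuma_inc_t yt_yg tpermD //.
    by apply/eqP => /(congr1 val) /= h; have := ltn_ord j; lia.
  by apply/eqP => /(congr1 val) /= h; have := ltn_ord j; lia.
- by rewrite !yokonuma_incD mulrDr mulrDl Qx Qy.
- by rewrite !yokonuma_incZ -scalerAl -scalerAr Qx.
- by rewrite !yokonuma_incM mulrA Qx -!mulrA Qy.
Qed.

End YokonumaTower.

(** * The spanning set of one algebra of the tower over the previous one *)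

Section YokonumaSpan.
Variables (K : fieldType) (d : nat) (u : K).
Local Notation Y := (yokonuma d u).
Local Notation inc := (yokonuma_inc d u _).
Local Notation g := (yg d u).
Local Notation t := (yt d u).
Local Notation e := (ye d u).

Lemma last_strands n (i : 'I_n.+1) : i = n :> nat ->
  (lower (n := n.+2) i = inc_strand ord_max) *
  (upper (n := n.+2) i = ord_max).
Proof. by move=> iE; split; apply: val_inj => /=; rewrite iE. Qed.

Lemma yt_yg_lower n (i : 'I_n.-1) k :
  t (lower i) ^+ k * g i = g i * t (upper i) ^+ k.
Proof. by rewrite yt_exp_yg tpermL. Qed.

Lemma yt_yg_upper n (i : 'I_n.-1) k :
  t (upper i) ^+ k * g i = g i * t (lower i) ^+ k.
Proof. by rewrite yt_exp_yg tpermR. Qed.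

(* Y_(n+1) is spanned by Y_n t_(n+1)^k and Y_n g_n Y_n: all statements about
   traces are proved by induction along this decomposition. *)
Inductive tower_span n : Y n.+1 -> Prop :=
| Span_add x y of tower_span x & tower_span y : tower_span (x + y)
| Span_scale k x of tower_span x : tower_span (k *: x)
| Span_t (a : Y n) k : tower_span (inc a * t ord_max ^+ k)
| Span_g (i : 'I_n) (a b : Y n) of i.+1 = n :
    tower_span (inc a * g (i : 'I_n.+1.-1) * inc b).

Lemma tower_span_sum n (I : finType) (F : I -> Y n.+1) :
  (forall i, tower_span (F i)) -> tower_span (\sum_i F i).
Proof.
move=> FS; apply: (big_ind (@tower_span n)) => [|x y|i _].
- by rewrite -(scale0r (inc 0 * t ord_max ^+ 0)); apply/Span_scale/Span_t.
- exact: Span_add.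
- exact: FS.
Qed.

Lemma tower_span_mull n (c : Y n) x : tower_span x -> tower_span (inc c * x).
Proof.
elim=> {x} [x y _ Sx _ Sy|k x _ Sx|a k|i a b iE].
- by rewrite mulrDr; apply: Span_add.
- by rewrite -scalerAr; apply: Span_scale.
- by rewrite mulrA -yokonuma_incM; apply: Span_t.
- by rewrite !mulrA -yokonuma_incM; apply: Span_g.
Qed.

Lemma tower_span_mulr n (c : Y n) x : tower_span x -> tower_span (x * inc c).
Proof.
elim=> {x} [x y _ Sx _ Sy|k x _ Sx|a k|i a b iE].
- by rewrite mulrDl; apply: Span_add.
- by rewrite -scalerAl; apply: Span_scale.
- by rewrite -mulrA yt_max_inc mulrA -yokonuma_incM; apply: Span_t.
- by rewrite -!mulrA -yokonuma_incM mulrA; apply: Span_g.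
Qed.

Lemma yt_max_g n (i : 'I_n.+1) k : i = n :> nat ->
  t ord_max ^+ k * g (i : 'I_n.+2.-1) =
  g (i : 'I_n.+2.-1) * inc (t ord_max ^+ k).
Proof.
move=> iE; rewrite yokonuma_inc_tX.
by have [<- <-] := last_strands iE; rewrite yt_yg_upper.
Qed.

Lemma g_yt_max n (i : 'I_n.+1) k : i = n :> nat ->
  g (i : 'I_n.+2.-1) * t ord_max ^+ k =
  inc (t ord_max ^+ k) * g (i : 'I_n.+2.-1).
Proof.
move=> iE; rewrite yokonuma_inc_tX.
by have [<- <-] := last_strands iE; rewrite yt_yg_lower.
Qed.

Lemma span_e_yg n (i : 'I_n.+1) : i = n :> nat ->
  tower_span (e (i : 'I_n.+2.-1) * g (i : 'I_n.+2.-1)).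
Proof.
move=> iE; rewrite /ye /idem_e -scalerAl mulr_suml; apply: Span_scale.
apply: tower_span_sum => k; have [-> ->] := last_strands iE.
rewrite -mulrA yt_max_g // mulrA -yokonuma_inc_tX.
by apply: Span_g => /=; rewrite iE.
Qed.

Lemma span_e n (i : 'I_n.+1) : i = n :> nat ->
  tower_span (e (i : 'I_n.+2.-1)).
Proof.
move=> iE; rewrite /ye /idem_e; apply: Span_scale.
apply: tower_span_sum => k; have [-> ->] := last_strands iE.
by rewrite -yokonuma_inc_tX; apply: Span_t.
Qed.

Lemma span_inc n (a : Y n) : tower_span (inc a).
Proof. by rewrite -[inc a]mulr1 -(expr0 (t ord_max)); apply: Span_t. Qed.

(** In a term [inc a * g i * inc b] the power of the last [t] commutes with [inc b] and crosses
    [g i] by moving to the lower strand, where it joins [inc a]. *)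
Lemma span_t_max n x k : tower_span x ->
  tower_span (x * yt d u (ord_max : 'I_n.+1) ^+ k).
Proof.
elim=> {x} [x y _ Sx _ Sy|c x _ Sx|a j|i a b].
- by rewrite mulrDl; apply: Span_add.
- by rewrite -scalerAl; apply: Span_scale.
- by rewrite -mulrA -exprD; apply: Span_t.
case: n i a b => [[]//|n] i a b [iE].
rewrite -!mulrA -yt_max_inc [g _ * _]mulrA g_yt_max // -mulrA mulrA -yokonuma_incM mulrA.
by apply: Span_g; rewrite iE.
Qed.

Lemma span_yg2 n (i : 'I_n.+1) : i = n :> nat ->
  tower_span (g (i : 'I_n.+2.-1) ^+ 2).
Proof.
move=> iE; rewrite yg_quad; apply: Span_add; first apply: Span_add.
- by rewrite -(yokonuma_inc1 d u _); apply: span_inc.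
- by apply/Span_scale/span_e.
- by apply/Span_scale/span_e_yg.
Qed.

Lemma tower_spanP n (x : Y n.+1) : tower_span x.
Proof.
(* Closure under right multiplication is the form that passes to products in [x]; applied to 1 it
   gives the claim. *)
suff spanM s : tower_span s -> tower_span (s * x).
  by rewrite -[x]mul1r -(yokonuma_inc1 d u _); apply/spanM/span_inc.
elim: n x s => [|n IHn] x s.
  elim/yokonuma_ind: x s => [|[]//|j|x y Sx Sy|c x Sx|x y Sx Sy] s Ss.
  - by rewrite mulr1.
  - have -> : j = ord_max by rewrite [j]ord1 [ord_max]ord1.
    by rewrite -[t _]expr1; apply: span_t_max.
  - by rewrite mulrDr; apply: Span_add; [apply: Sx|apply: Sy].
  - by rewrite -scalerAr; apply: Span_scale; apply: Sx.
  - by rewrite mulrA; apply/Sy/Sx.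
have {}IHn (b : Y n.+1) : tower_span b.
  by rewrite -[b]mul1r -(yokonuma_inc1 d u _); apply/IHn/span_inc.
elim/yokonuma_ind: x s => [|i|j|x y Sx Sy|c x Sx|x y Sx Sy] s Ss.
- by rewrite mulr1.
- have [[j ->]|iE] := ord_lift_or_last (i : 'I_n.+1).
    have -> : inc_strand j = inc_gen (n := n.+1) j :> 'I_n.+1 by exact: val_inj.
    by rewrite -yokonuma_inc_g; apply: tower_span_mulr.
  have {}iE : i = n :> nat by rewrite iE.
  elim: Ss => {s} [x y _ Sx _ Sy|c x _ Sx|a k|j a b [jE]].
  + by rewrite mulrDl; apply: Span_add.
  + by rewrite -scalerAl; apply: Span_scale.
  + rewrite -mulrA yt_max_g // mulrA; apply: Span_g; by rewrite iE.
  have -> : j = i by apply: ord_inj; rewrite jE iE.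
  rewrite -!mulrA; apply: tower_span_mull.
  (* What remains is [g i * inc b * g i]. Decompose [b] one level down: a term with a power of [t]
     produces [g i ^+ 2], and a term with [g l] is reduced by the braid relation to a single
     [g i]. *)
  elim: (IHn b) => {b} [x y _ Sx _ Sy|c x _ Sx|b k|l b c lE].
  + by rewrite yokonuma_incD mulrDl mulrDr; apply: Span_add.
  + by rewrite yokonuma_incZ -scalerAl -scalerAr; apply: Span_scale.
  + rewrite yokonuma_incM mulrA mulrA (yg_max_inc2 _ iE) -!mulrA.
    rewrite yokonuma_inc_tX.
    have [<- _] := last_strands iE.
    rewrite yt_yg_lower (mulrA (g i)) -expr2 (last_strands iE).2.
    by apply: tower_span_mull; apply: span_t_max; apply: span_yg2.
  rewrite !yokonuma_incM; set b' := inc (inc b); set c' := inc (inc c).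
  have -> : g i * (b' * inc (g (l : 'I_n.+1.-1)) * c' * g i) =
            b' * (g i * inc (g (l : 'I_n.+1.-1)) * g i) * c'.
    by rewrite -!mulrA -(yg_max_inc2 _ iE) !mulrA (yg_max_inc2 _ iE).
  apply: tower_span_mulr; apply: tower_span_mull.
  rewrite yokonuma_inc_g yg_braid -?yokonuma_inc_g; last by rewrite iE /= lE.
  by apply: Span_g; rewrite iE.
- have [[k ->]|->] := ord_lift_or_last j.
    by rewrite -yokonuma_inc_t; apply: tower_span_mulr.
  by rewrite -[t _]expr1; apply: span_t_max.
- by rewrite mulrDr; apply: Span_add; [apply: Sx|apply: Sy].
- by rewrite -scalerAr; apply: Span_scale; apply: Sx.
- by rewrite mulrA; apply/Sy/Sx.
Qed.

End YokonumaSpan.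

(** * The Juyumaya trace *)

Section JuyumayaTrace.
Variables (K : numFieldType) (d : nat) (u z : K) (x : nat -> K).
Local Notation Y := (yokonuma d u).
Local Notation inc := (yokonuma_inc d u _).
Local Notation g := (yg d u).
Local Notation t := (yt d u).
Local Notation e := (ye d u).
Variable tr : forall n, {scalar Y n}.
Hypothesis d_gt0 : (0 < d)%N.
Hypothesis trP : juyumaya_trace z x tr.

Local Notation E := (trace_e tr).

Lemma tr_one n : tr n 1 = 1.
Proof.
case: trP => tr0 trI _ _ _; elim: n => // n IHn.
by rewrite -(yokonuma_inc1 d u) trI.
Qed.

Lemma tr_inc n (a : Y n) : tr n.+1 (inc a) = tr n a.
Proof. by case: trP. Qed.

Lemma trC n (a b : Y n) : tr n (a * b) = tr n (b * a).
Proof. by case: trP. Qed.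

Lemma trD n (a b : Y n) : tr n (a + b) = tr n a + tr n b.
Proof. exact: raddfD. Qed.

Lemma trZ n k (a : Y n) : tr n (k *: a) = k * tr n a.
Proof. exact: linearZ. Qed.

Lemma tr_sum n (I : finType) (F : I -> Y n) :
  tr n (\sum_i F i) = \sum_i tr n (F i).
Proof. exact: raddf_sum. Qed.

Lemma tr_g n (i : 'I_n.+1) (a : Y n.+1) : i = n :> nat ->
  tr n.+2 (inc a * g (i : 'I_n.+2.-1)) = z * tr n.+1 a.
Proof.
move=> iE; case: trP => _ _ _ trg _.
by have -> : i = ord_max by apply: ord_inj.
Qed.

Lemma yt_mod n (j : 'I_n) k : t j ^+ (k %% d) = t j ^+ k.
Proof.
by rewrite [in RHS](divn_eq k d) exprD mulnC exprM yt_d expr1n mul1r.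
Qed.

Lemma tr_tX n (a : Y n) k :
  tr n.+1 (inc a * t ord_max ^+ k) = xmod d x k * tr n a.
Proof.
rewrite -yt_mod /xmod; case: eqP => [->|/eqP k0].
  by rewrite expr0 mulr1 mul1r tr_inc.
by case: trP => _ _ _ _ ->; rewrite // lt0n k0 ltn_mod.
Qed.

Lemma tr_e_expand n (i : 'I_n.+1) (a : Y n.+1) : i = n :> nat ->
  tr n.+2 (inc a * e (i : 'I_n.+2.-1)) =
  d%:R^-1 * \sum_(s < d) xmod d x (d - s) * tr n.+1 (a * t ord_max ^+ s).
Proof.
move=> iE; rewrite /ye /idem_e -scalerAr trZ mulr_sumr tr_sum; congr (_ * _).
apply: eq_bigr => s _; have [-> ->] := last_strands iE.
by rewrite mulrA -yokonuma_inc_tX -yokonuma_incM tr_tX.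
Qed.

Lemma trace_eE :
  E = d%:R^-1 * \sum_(s < d) xmod d x s * xmod d x (d - s).
Proof.
rewrite /trace_e -[e _]mul1r -(yokonuma_inc1 d u) tr_e_expand //; congr (_ * _).
apply: eq_bigr => s _; rewrite -(yokonuma_inc1 d u 0) tr_tX tr_one.
by rewrite mulr1 mulrC.
Qed.

Lemma xmod_mod k : xmod d x (k %% d) = xmod d x k.
Proof. by rewrite /xmod modn_mod. Qed.

Lemma xmod0 : xmod d x 0 = 1.
Proof. by rewrite /xmod mod0n. Qed.

(** Moving the upper power of [t] across [g] turns each summand of [e] into conjugation of [g] by a
    power of the lower [t]; cyclicity and [t ^+ d = 1] make all [d] summands contribute equally. *)
Lemma tr_eg n (i : 'I_n.+1) (a : Y n.+1) : i = n :> nat ->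
  tr n.+2 (inc a * (e (i : 'I_n.+2.-1) * g (i : 'I_n.+2.-1))) = z * tr n.+1 a.
Proof.
move=> iE; rewrite /ye /idem_e -scalerAl -scalerAr trZ mulr_suml mulr_sumr tr_sum.
rewrite (eq_bigr (fun=> z * tr n.+1 a)); last first.
  move=> s _; rewrite -[_ * g _]mulrA yt_yg_upper !mulrA trC !mulrA.
  rewrite (last_strands iE).1 -!yokonuma_inc_tX -!yokonuma_incM tr_g //.
  rewrite trC mulrA -exprD subnKC ?yt_d ?mul1r //.
  exact/ltnW/ltn_ord.
rewrite sumr_const card_ord -[(_ * tr _ _) *+ d]mulr_natl mulrA mulVf ?mul1r //.
by rewrite pnatr_eq0 -lt0n.
Qed.

Hypothesis xE : E_system d x.

(** Extends the E-system to all indices: for [k] divisible by [d] it is the formula for [E]. *)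
Lemma E_systemE k :
  \sum_(s < d) xmod d x (k + s) * xmod d x (d - s) = xmod d x k * (d%:R * E).
Proof.
rewrite trace_eE mulVKf ?pnatr_eq0 -?lt0n //.
rewrite -[xmod d x k]xmod_mod.
rewrite (eq_bigr (fun s : 'I_d => xmod d x (k %% d + s) * xmod d x (d - s))); last first.
  by move=> s _; rewrite -xmod_mod -modnDml xmod_mod.
have [->|k0] := eqVneq (k %% d)%N 0%N; first by rewrite xmod0 mul1r.
by apply: xE; rewrite lt0n k0 ltn_mod.
Qed.

(** On [inc a * t ord_max ^+ k] this is the E-system. On a term containing [g], the powers of [t]
    cross [g] to the lower strand, the Markov property removes [g], and the sum becomes the same one
    for [b * a] one level down. *)
Lemma tr_e_sum n (a : Y n.+1) :
  \sum_(s < d) xmod d x (d - s) * tr n.+1 (a * t ord_max ^+ s) =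
  d%:R * E * tr n.+1 a.
Proof.
elim: n a => [|n IHn] a; elim: (tower_spanP a) => {a} [a b _ Qa _ Qb|k a _ Qa|a k|i a b iE].
1,5: rewrite trD mulrDr -Qa -Qb -big_split /=;
  by apply: eq_bigr => s _; rewrite mulrDl trD mulrDr.
1,4: rewrite trZ mulrCA -Qa mulr_sumr;
  by apply: eq_bigr => s _; rewrite -scalerAl trZ mulrCA.
1,3: rewrite tr_tX mulrA [_ * xmod d x k]mulrC -E_systemE mulr_suml;
  by apply: eq_bigr => s _; rewrite -mulrA -exprD tr_tX mulrCA mulrA.
- by [].
case: iE => iE; have {}iE : i = n :> nat by [].
rewrite trC mulrA -yokonuma_incM tr_g // mulrCA -IHn mulr_sumr.
apply: eq_bigr => s _; rewrite mulrCA; congr (_ * _).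
rewrite -mulrA -yt_max_inc mulrA trC !mulrA -yokonuma_incM -mulrA g_yt_max //.
by rewrite mulrA -yokonuma_incM tr_g.
Qed.

Lemma tr_e n (i : 'I_n.+1) (a : Y n.+1) : i = n :> nat ->
  tr n.+2 (inc a * e (i : 'I_n.+2.-1)) = E * tr n.+1 a.
Proof.
move=> iE; rewrite tr_e_expand // tr_e_sum !mulrA mulVf ?mul1r //.
by rewrite pnatr_eq0 -lt0n.
Qed.

End JuyumayaTrace.

(** * Solutions of the E-system *)

Section Circulant.
Variables (K : numFieldType).

(** Take a rank factorization of [A] into [C] and [W]. Cancelling [C] on the left and [W] on the
    right in $CWCW = CW$ leaves $WC = 1$, an identity matrix of size the rank, and $CW$ and $WC$
    have the same trace. *)
Lemma mxtrace_idem n (A : 'M[K]_n) : A *m A = A -> \tr A = (\rank A)%:R.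
Proof.
have key r (C : 'M[K]_(n, r)) (W : 'M_(r, n)) L S : L *m C = 1%:M ->
    W *m S = 1%:M -> C *m W *m (C *m W) = C *m W -> W *m C = 1%:M.
  move=> LC WS /(congr1 (fun B => L *m B *m S)).
  by rewrite !mulmxA LC mul1mx -!mulmxA WS !mulmx1.
move=> AA; have [L LC] := row_fullP (col_base_full A).
have [S RS] := row_freeP (row_base_free A).
rewrite -[in LHS](mulmx_base A) mxtrace_mulC (key _ _ _ _ _ LC RS) ?mxtrace1 //.
by rewrite mulmx_base.
Qed.

Lemma mxrank1_minor m n (A : 'M[K]_(m, n)) : \rank A = 1%N ->
  forall i j k l, A i j * A k l = A i l * A k j.
Proof.
move=> r1; rewrite -(mulmx_base A); move: (col_base A) (row_base A).
rewrite r1 => C S i j k l; rewrite !mxE !big_ord1; ring.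
Qed.

Variables (d : nat) (E : K) (X : 'I_d.+1 -> K).
Hypothesis X0 : X 0 = 1.
Hypothesis XE : forall m, \sum_s X (m + s) * X (- s) = X m * (d.+1%:R * E).

(** The circulant matrix of the sequence, normalised to have trace 1; the convolution identity [XE]
    becomes $A^2 = EA$. *)
Let A : 'M[K]_d.+1 := \matrix_(i, j) (X (i - j) / d.+1%:R).

Let d_neq0 : d.+1%:R != 0 :> K. Proof. by rewrite pnatr_eq0. Qed.

Let AA : A *m A = E *: A.
Proof.
apply/matrixP => i k; rewrite !mxE.
rewrite (reindex_inj (addrI i)) /=.
have -> : E * (X (i - k) / d.+1%:R) = X (i - k) * (d.+1%:R * E) / d.+1%:R ^+ 2.
  by move: d.+1%:R d_neq0 => D D0; field.
rewrite -XE mulr_suml; apply: eq_bigr => s _; rewrite !mxE.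
rewrite opprD addNKr addrAC.
by move: d.+1%:R d_neq0 => D D0; field.
Qed.

Let trA : \tr A = 1.
Proof.
rewrite /mxtrace (eq_bigr (fun=> d.+1%:R^-1)); last first.
  by move=> i _; rewrite mxE subrr X0 mul1r.
by rewrite sumr_const card_ord -[_ *+ _]mulr_natr mulVf.
Qed.

(** For $E = -1$ the matrix $-A$ would be idempotent of trace $-1$, whereas the trace of an
    idempotent is its rank. *)
Lemma idempotent_sequence_neqN1 : E != -1.
Proof.
apply/eqP => E1; have : (- A) *m (- A) = - A.
  by rewrite mulNmx mulmxN opprK AA E1 scaleN1r.
move/mxtrace_idem; rewrite linearN /= trA => /eqP.
by rewrite lt_eqF // (lt_le_trans (ltrN10 K)) ?ler0n.
Qed.

(** For $E = 1$ the matrix $A$ is idempotent of trace 1, hence of rank one, and its two-by-two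
    minors vanish. *)
Lemma idempotent_sequenceM : E = 1 -> forall a b, X (a + b) = X a * X b.
Proof.
move=> E1; have r1 : \rank A = 1%N.
  apply/eqP; rewrite -(eqr_nat K) -mxtrace_idem ?trA //.
  by rewrite AA E1 scale1r.
(* The minor on rows [a], [0] and columns [0], [- b] has entries X(a), X(a + b), X(0) = 1 and X(b),
   up to the normalisation. *)
move=> a b; have := mxrank1_minor r1 a 0 0 (- b).
rewrite !mxE !subr0 !opprK add0r X0 => h.
have -> : X a * X b = X a / d.+1%:R * (X b / d.+1%:R) * d.+1%:R ^+ 2.
  by move: d.+1%:R d_neq0 => D D0; field.
by rewrite h; move: d.+1%:R d_neq0 => D D0; field.
Qed.

End Circulant.

Lemma E_system_solution (K : numFieldType) (d : nat) (x : nat -> K) (E : K) :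
  (0 < d)%N ->
  (forall k, \sum_(s < d) xmod d x (k + s) * xmod d x (d - s) =
     xmod d x k * (d%:R * E)) ->
  E != -1 /\
  (E = 1 -> forall a b, xmod d x (a + b) = xmod d x a * xmod d x b).
Proof.
case: d => // d _ xE; pose X (i : 'I_d.+1) := xmod d.+1 x i.
have X0 : X 0 = 1 by rewrite /X xmod0.
have XE m : \sum_s X (m + s) * X (- s) = X m * (d.+1%:R * E).
  rewrite -xE; apply: eq_bigr => s _.
  by rewrite /X /= !xmod_mod.
split=> [|E1 a b]; first exact: idempotent_sequence_neqN1 X0 XE.
have := idempotent_sequenceM X0 XE E1 (inord (a %% d.+1)) (inord (b %% d.+1)).
by rewrite /X /= !inordK ?ltn_mod // modnDm !xmod_mod.
Qed.

(** * Traces of products with [t_j], [e_i] and [y_i] *)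

Section TracesOfBraids.
Variables (K : numFieldType) (d : nat) (u z : K) (x : nat -> K).
Local Notation Y := (yokonuma d u).
Local Notation inc := (yokonuma_inc d u _).
Local Notation g := (yg d u).
Local Notation t := (yt d u).
Local Notation e := (ye d u).
Variable tr : forall n, {scalar Y n}.
Hypothesis d_gt0 : (0 < d)%N.
Hypothesis trP : juyumaya_trace z x tr.
Local Notation E := (trace_e tr).

Section Multiplicative.
Hypothesis xM : forall a b, xmod d x (a + b) = xmod d x a * xmod d x b.

(** Multiplicativity of the x_m extends the rule for the last strand to every strand: by the tower
    decomposition, [t j] is absorbed into the smaller algebra, either directly or after crossing
    [g]. *)
Lemma tr_mul_tX n (j : 'I_n) (a : Y n) k :
  tr n (a * t j ^+ k) = xmod d x k * tr n a.
Proof.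
elim: n j a => [[]//|n IHn] j a.
elim: (tower_spanP a) => {a} [a b _ Qa _ Qb|c a _ Qa|a m|i a b iE].
- by rewrite mulrDl !trD Qa Qb mulrDr.
- by rewrite -scalerAl !trZ Qa mulrCA.
- have [[l ->]|->] := ord_lift_or_last j; last first.
    by rewrite -mulrA -exprD !(tr_tX d_gt0 trP) mulrA -xM addnC.
  rewrite -yokonuma_inc_tX -mulrA yt_max_inc mulrA -yokonuma_incM.
  by rewrite !(tr_tX d_gt0 trP) IHn mulrCA.
case: n IHn i a b j iE => [|n] IHn i a b j iE; first by case: i {iE}.
case: iE => iE; rewrite [in RHS](trC trP) mulrA -yokonuma_incM (tr_g trP) //.
have [[l ->]|->] := ord_lift_or_last j.
  rewrite -mulrA -yokonuma_inc_tX -yokonuma_incM (trC trP) mulrA -yokonuma_incM.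
  rewrite (tr_g trP) // (trC trP) mulrA IHn mulrCA.
  by rewrite (trC trP a).
rewrite -mulrA -yt_max_inc !mulrA -(mulrA (inc a)) g_yt_max // (trC trP) !mulrA.
by rewrite -!yokonuma_incM (tr_g trP) // IHn mulrCA mulrA.
Qed.

Lemma tr_mul_e n (i : 'I_n.-1) (a : Y n) : E = 1 -> tr n (a * e i) = tr n a.
Proof.
move=> E1; rewrite -[RHS]mul1r -E1 (trace_eE d_gt0 trP).
rewrite /ye /idem_e -scalerAr trZ mulr_sumr tr_sum -mulrA; congr (_ * _).
rewrite mulr_suml; apply: eq_bigr => s _.
by rewrite mulrA !tr_mul_tX mulrA [xmod d x s * _]mulrC.
Qed.

End Multiplicative.

Hypothesis xE : E_system d x.

(* The element y_i of the header, locked so that rewriting with [mulrA] does not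
   unfold it. *)
Definition yb n (i : 'I_n.-1) : Y n := locked (e i * (1 + g i)).

Lemma ybE n (i : 'I_n.-1) : yb i = e i * (1 + g i).
Proof. by rewrite /yb -lock. Qed.

Lemma yg_sqr n (i : 'I_n.-1) : g i ^+ 2 = 1 + (u - 1) *: yb i.
Proof. by rewrite yg_quad ybE mulrDr mulr1 scalerDr addrA. Qed.

Lemma yb_yg n (i : 'I_n.-1) : yb i * g i = u *: yb i.
Proof.
rewrite ybE -mulrA mulrDl mul1r mulrDr -expr2 ye_yg_quad mulrDr mulr1.
rewrite addrCA -{1}[e i * g i]scale1r -scalerDl [1 + _]addrC subrK.
by rewrite scalerDr.
Qed.

Lemma yg_yb n (i : 'I_n.-1) : g i * yb i = u *: yb i.
Proof.
rewrite -yb_yg !ybE [LHS]mulrA -ye_yg -!mulrA; congr (_ * _).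
by rewrite mulrDr mulrDl mulr1 mul1r.
Qed.

Lemma yokonuma_inc_yb n (i : 'I_n.-1) : inc (yb i) = yb (inc_gen i).
Proof.
rewrite !ybE yokonuma_incM yokonuma_incD yokonuma_inc1.
by rewrite yokonuma_inc_e yokonuma_inc_g.
Qed.

Lemma tr_yb n (i : 'I_n.+1) (a : Y n.+1) : i = n :> nat ->
  tr n.+2 (inc a * yb (i : 'I_n.+2.-1)) = (E + z) * tr n.+1 a.
Proof.
move=> iE; rewrite ybE mulrDr mulr1 mulrDr trD (tr_e d_gt0 trP xE) //.
by rewrite (tr_eg d_gt0 trP) // mulrDl.
Qed.

Lemma yt_yeC n (i : 'I_n.-1) j k : t j ^+ k * e i = e i * t j ^+ k.
Proof.
rewrite /ye /idem_e -scalerAl -scalerAr mulr_suml mulr_sumr.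
congr (_ *: _); apply: eq_bigr => s _.
by apply: commrM; apply: yt_exp_comm.
Qed.

Lemma ye_ytX n (i : 'I_n.-1) k : e i * t (upper i) ^+ k = e i * t (lower i) ^+ k.
Proof.
elim: k => [|k IHk]; first by rewrite !expr0.
by rewrite exprSr mulrA IHk -mulrA yt_exp1 mulrA -ye_yt -mulrA -exprS.
Qed.

(** Moving past [g j * g i] carries the two strands of [i] to the two strands of [j]. *)
Lemma yg_yg_ye n (i j : 'I_n.-1) : j = i.+1 :> nat ->
  g j * g i * e j = e i * (g j * g i).
Proof.
move=> ij; rewrite /ye /idem_e -scalerAl -scalerAr mulr_suml mulr_sumr.
congr (_ *: _); apply: eq_bigr => s _.
have lj : lower j = upper i by apply: val_inj; rewrite /= ij.
have ui : upper j != lower i by apply/eqP => /(congr1 val) /=; rewrite ij; lia.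
have li : lower i != lower j by apply/eqP => /(congr1 val) /=; rewrite ij; lia.
have far k l (j' : 'I_n.-1) : k != lower j' -> k != upper j' ->
    t k ^+ l * g j' = g j' * t k ^+ l.
  by move=> kl ku; rewrite yt_exp_yg tpermD // eq_sym.
have lu : lower i != upper j by apply/eqP => /(congr1 val) /=; rewrite ij; lia.
have uj : upper j != upper i by apply/eqP => /(congr1 val) /=; rewrite ij; lia.
have -> : t (lower i) ^+ s * t (upper i) ^+ (d - s) * (g j * g i) =
    t (lower i) ^+ s * (t (lower j) ^+ (d - s) * g j) * g i.
  by rewrite lj !mulrA.
rewrite yt_yg_lower !mulrA (far _ _ _ li lu).
rewrite -(mulrA _ _ (g i)) (far _ _ _ ui uj) -(mulrA (g j)) -(mulrA (g j)).
by rewrite [t _ ^+ s * _]mulrA yt_yg_lower lj !mulrA.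
Qed.

Lemma yg_yg_yb n (i j : 'I_n.-1) : j = i.+1 :> nat ->
  g j * g i * yb j = yb i * (g j * g i).
Proof.
move=> ij; rewrite !ybE mulrA yg_yg_ye // -!mulrA; congr (_ * _).
by rewrite mulrDr mulrDr mulr1 mulrDl mul1r !mulrA yg_braid.
Qed.

Lemma yb_max_inc2 n (i : 'I_n.+1) (a : Y n) : i = n :> nat ->
  yb (i : 'I_n.+2.-1) * inc (inc a) = inc (inc a) * yb (i : 'I_n.+2.-1).
Proof.
move=> iE; rewrite ybE; apply/commr_sym; apply: commrM; last first.
  by apply: commrD; [apply: commr1|apply/commr_sym/yg_max_inc2].
rewrite /ye /idem_e -mulr_algl; apply: commrM.
  by apply: commr_sym; rewrite /GRing.comm mulr_algl mulr_algr.
apply: commr_sum => s _; have [-> ->] := last_strands iE; apply: commrM.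
  by rewrite -yokonuma_inc_tX /GRing.comm -!yokonuma_incM yt_max_inc.
by apply/commr_sym/yt_max_inc.
Qed.

(** For the last generator and [a] from the smaller algebra, the trace has the factor $E + z = 0$.
    The tower decomposition, used once for [a] and once more inside it, reduces the other products
    to this one or to the induction hypothesis. *)
Lemma tr_yb_eq0 n (i : 'I_n) (a : Y n.+1) : z = - E ->
  tr n.+1 (a * yb (i : 'I_n.+1.-1)) = 0.
Proof.
move=> zE; elim: n i a => [[]//|n IHn] i a.
have [[l ->]|imax] := ord_lift_or_last i.
  have -> : yb (inc_strand l : 'I_n.+2.-1) = inc (yb (l : 'I_n.+1.-1)).
    by rewrite yokonuma_inc_yb; congr yb; apply: val_inj.
  elim: (tower_spanP a) => {a} [a b _ Qa _ Qb|c a _ Qa|a m|j a b jE].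
  - by rewrite mulrDl trD Qa Qb addr0.
  - by rewrite -scalerAl trZ Qa mulr0.
  - by rewrite -mulrA yt_max_inc mulrA -yokonuma_incM (tr_tX d_gt0 trP) IHn mulr0.
  case: jE => jE; rewrite -mulrA -yokonuma_incM (trC trP) mulrA -yokonuma_incM.
  by rewrite (tr_g trP) // (trC trP) mulrA IHn mulr0.
have {imax} iE : i = n :> nat by rewrite imax.
(* [e i] identifies the [t] of its two strands, so a power on the last strand can be moved into the
   smaller algebra. *)
have trt (b : Y n.+1) k :
    tr n.+2 (inc b * t ord_max ^+ k * yb (i : 'I_n.+2.-1)) = 0.
  have [lE uE] := last_strands iE.
  rewrite -mulrA ybE [t _ ^+ k * _]mulrA -{1}uE yt_yeC ye_ytX -yt_yeC lE -mulrA mulrA.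
  rewrite -yokonuma_inc_tX -yokonuma_incM -ybE tr_yb //.
  by rewrite zE addrN mul0r.
elim: (tower_spanP a) => {a} [a b _ Qa _ Qb|c a _ Qa|a m|j a b [jE]].
- by rewrite mulrDl trD Qa Qb addr0.
- by rewrite -scalerAl trZ Qa mulr0.
- exact: trt.
have -> : j = i by apply: ord_inj; rewrite jE iE.
elim: (tower_spanP b) => {b} [b b' _ Qb _ Qb'|c b _ Qb|b m|l b c lE].
- by rewrite yokonuma_incD mulrDr mulrDl trD Qb Qb' addr0.
- by rewrite yokonuma_incZ -scalerAr -scalerAl trZ Qb mulr0.
- rewrite yokonuma_incM mulrA -(mulrA (inc a)) (yg_max_inc2 _ iE) mulrA.
  rewrite -yokonuma_incM -(mulrA (inc _)) -yt_max_g // mulrA -mulrA yg_yb.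
  by rewrite -scalerAr trZ trt mulr0.
have yc := yb_max_inc2 c iE.
(* Moving [y_i] to the left through [g i * g l] makes it [y_l], which lies one level down; the
   Markov property then removes [g i]. *)
have : g (i : 'I_n.+2.-1) * inc (g (l : 'I_n.+1.-1)) * yb (i : 'I_n.+2.-1) =
    inc (yb (l : 'I_n.+1.-1)) * (g (i : 'I_n.+2.-1) * inc (g (l : 'I_n.+1.-1))).
  by rewrite yokonuma_inc_yb yokonuma_inc_g yg_yg_yb //= iE lE.
have lg k : tr n.+1 (g (l : 'I_n.+1.-1) * k * yb (l : 'I_n.+1.-1)) = 0 by exact: IHn.
move: (yb _) yc (yb _) (g (l : 'I_n.+1.-1)) lg => y yc y' g' lg gy.
have -> : inc a * g (i : 'I_n.+2.-1) * inc (inc b * g' * inc c) * y =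
    inc (a * inc b) * (g (i : 'I_n.+2.-1) * inc g' * y) * inc (inc c).
  rewrite !yokonuma_incM -!mulrA yc !mulrA -(mulrA (inc a)) (yg_max_inc2 _ iE).
  by rewrite !mulrA.
rewrite gy !mulrA -yokonuma_incM (trC trP) !mulrA -yokonuma_incM (trC trP) !mulrA.
by rewrite -!yokonuma_incM (tr_g trP) // !mulrA -(mulrA g') -(mulrA g') lg mulr0.
Qed.

(** Expand the right factor [e i]. Its lower [t] commutes with [g j] and is turned by the left [e i]
    into [t (lower j)]; its upper [t] becomes [t (upper j)] in crossing [g j]. The sum is then
    [e j]. *)
Lemma ye_yg_ye n (i j : 'I_n.-1) : j = i.+1 :> nat ->
  e i * g j * e i = e i * e j * g j.
Proof.
move=> ij; have lj : lower j = upper i by apply: val_inj; rewrite /= ij.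
have li : lower j != lower i by apply/eqP => /(congr1 val) /=; rewrite ij; lia.
have ui : upper j != lower i by apply/eqP => /(congr1 val) /=; rewrite ij; lia.
have mule y (l : 'I_n.-1) : y * e l =
    d%:R^-1 *: \sum_(s < d) y * (t (lower l) ^+ s * t (upper l) ^+ (d - s)).
  by rewrite -mulr_sumr scalerAr.
rewrite (mule (e i * g j)) (mule (e i)) -[RHS]scalerAl mulr_suml; congr (_ *: _).
apply: eq_bigr => s _.
rewrite mulrA -(mulrA (e i)).
have -> : g j * t (lower i) ^+ s = t (lower i) ^+ s * g j.
  by rewrite yt_exp_yg tpermD.
by rewrite mulrA -ye_ytX -!mulrA yt_yg_upper lj.
Qed.

Lemma yg_yg_ye_low n (i j : 'I_n.-1) : j = i.+1 :> nat ->
  g i * g j * e i = e j * (g i * g j).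
Proof.
move=> ij; rewrite /ye /idem_e -scalerAl -scalerAr mulr_suml mulr_sumr.
congr (_ *: _); apply: eq_bigr => s _.
have lj : lower j = upper i by apply: val_inj; rewrite /= ij.
have li : lower j != lower i by apply/eqP => /(congr1 val) /=; rewrite ij; lia.
have ui : upper j != lower i by apply/eqP => /(congr1 val) /=; rewrite ij; lia.
have lu : upper j != upper i by apply/eqP => /(congr1 val) /=; rewrite ij; lia.
have tlg k : t (lower i) ^+ k * g j = g j * t (lower i) ^+ k.
  by rewrite yt_exp_yg tpermD.
have tug k : t (upper j) ^+ k * g i = g i * t (upper j) ^+ k.
  by rewrite yt_exp_yg tpermD // eq_sym.
rewrite -!mulrA [in RHS](mulrA (t (upper j) ^+ _)) tug -mulrA yt_yg_upper.
rewrite [in RHS](mulrA (t (lower j) ^+ s)) lj yt_yg_upper -mulrA.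
by rewrite [in RHS](mulrA (t (lower i) ^+ s)) tlg -lj !mulrA.
Qed.

(** The part of the trace of s2 s1^2 s2 s1^2 that the Markov rules do not give directly. Cyclicity
    and [ye_yg_ye] collapse the two factors [y_i] into one. *)
Lemma tr_yb_far (i : 'I_3.-1) (j : 'I_3.-1) : i = 0%N :> nat -> j = 1%N :> nat ->
  tr 3 (g j * yb i * g j * yb i) =
  (E + z) * (u * E + (u - 1) * z + u ^+ 2 * z).
Proof.
move=> i0 j1; have ij : j = i.+1 :> nat by rewrite i0.
pose b : Y 2 := yb (ord0 : 'I_2.-1).
have ib : inc b = yb i by rewrite yokonuma_inc_yb; congr yb; apply: val_inj.
have trb : tr 2 b = E + z.
  have := @tr_yb 0 ord0 1 erefl.
  by rewrite yokonuma_inc1 mul1r (tr_one trP) // mulr1.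
have yE : yb i = (1 + g i) * e i.
  by rewrite ybE mulrDr mulrDl mulr1 mul1r ye_yg.
have yey : yb i * g j * yb i = yb i * (e j * (g j * (1 + g i))).
  transitivity ((1 + g i) * (e i * g j * e i) * (1 + g i)).
    by rewrite {1}yE ybE !mulrA.
  by rewrite ye_yg_ye // {1}yE !mulrA.
have -> : tr 3 (g j * yb i * g j * yb i) =
    tr 3 (yb i * (e j * (g j * (1 + g i) * g j))).
  by rewrite -!mulrA (trC trP) (mulrA (yb i)) yey !mulrA.
(* The braid relation leaves one [g j] in the last term, which the trace can remove once the factors
   with index [i] are brought together by cyclicity. *)
have -> : e j * (g j * (1 + g i) * g j) =
    u *: e j + (u - 1) *: (e j * g j) + g i * g j * (e i * g i).
  rewrite mulrDr mulr1 mulrDl -expr2 mulrDr ye_yg_quad; congr (_ + _).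
  by rewrite yg_braid // !mulrA yg_yg_ye_low // !mulrA.
have -> : tr 3 (yb i * (u *: e j + (u - 1) *: (e j * g j) + g i * g j * (e i * g i)))
    = tr 3 (yb i * (u *: e j + (u - 1) *: (e j * g j))) + u ^+ 2 * tr 3 (yb i * g j).
  rewrite mulrDr trD; congr (_ + _); rewrite mulrA (trC trP) !mulrA.
  have -> : e i * g i * yb i * g i = u ^+ 2 *: yb i.
    rewrite -(mulrA (e i)) yg_yb -(scalerAr u) -(scalerAl u) -mulrA yb_yg.
    by rewrite -(scalerAr u) scalerA -expr2 ybE mulrA ye_idem.
  by rewrite -(scalerAl (u ^+ 2)) trZ.
rewrite mulrDr trD -(scalerAr u) -(scalerAr (u - 1)) !trZ -ib.
rewrite (tr_e d_gt0 trP xE) // (tr_eg d_gt0 trP) // (tr_g trP) // trb; ring.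
Qed.

Lemma tr2_yb : tr 2 (yb (ord0 : 'I_2.-1)) = E + z.
Proof.
have := @tr_yb 0 ord0 1 erefl.
by rewrite yokonuma_inc1 mul1r (tr_one trP) // mulr1.
Qed.

Lemma tr2_yg : tr 2 (g (ord0 : 'I_2.-1)) = z.
Proof.
have := @tr_g _ _ _ _ _ _ trP 0 ord0 1 erefl.
by rewrite yokonuma_inc1 mul1r (tr_one trP) // mulr1.
Qed.

End TracesOfBraids.

(** * Ocneanu traces *)

Section HeckeMarkov.
Variables (K : fieldType) (q : K).
Local Notation H := (hecke q).
Local Notation inc := (hecke_inc q _).
Local Notation G := (hG q).
Local Notation Y := (yokonuma 1 q).

Lemma hecke_incM n (a b : H n) : inc (a * b) = inc a * inc b.
Proof. exact: rmorphM. Qed.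

Lemma hecke_incD n (a b : H n) : inc (a + b) = inc a + inc b.
Proof. exact: rmorphD. Qed.

Lemma hecke_incZ n k (a : H n) : inc (k *: a) = k *: inc a.
Proof. exact: linearZ. Qed.

Lemma hecke_inc1 n : inc (1 : H n) = 1.
Proof. exact: rmorph1. Qed.

Lemma idem_e_one n (A : algType K) (i : 'I_n.-1) :
  idem_e 1 (fun=> 1 : A) i = 1.
Proof. by rewrite /idem_e big_ord1 !expr1n mulr1 invr1 scale1r. Qed.

(* For d = 1 this is an isomorphism; its surjectivity transfers the spanning
   lemma [tower_spanP] to the Hecke algebras. *)
Definition yokonuma_to_hecke n : {lrmorphism Y n -> H n}.
Proof.
apply: (@yokonuma_lift K 1 q n (H n) (fun i => G i) (fun=> 1)) => //.
- exact: hG_far.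
- exact: hG_braid.
- by move=> j i; rewrite mul1r mulr1.
move=> i; rewrite idem_e_one mul1r hG_quad addrC; congr (_ + _).
by rewrite -[X in _ = X + _]scale1r -scalerDl addrC subrK.
Defined.

Lemma yokonuma_to_hecke_g n i : yokonuma_to_hecke n (yg 1 q i) = G i.
Proof. exact: yokonuma_lift_g. Qed.

Lemma yokonuma_to_hecke_t n j : yokonuma_to_hecke n (yt 1 q j) = 1.
Proof. exact: yokonuma_lift_t. Qed.

Lemma yokonuma_to_heckeM n a b : yokonuma_to_hecke n (a * b) =
  yokonuma_to_hecke n a * yokonuma_to_hecke n b.
Proof. exact: rmorphM. Qed.

Lemma yokonuma_to_heckeD n a b : yokonuma_to_hecke n (a + b) =
  yokonuma_to_hecke n a + yokonuma_to_hecke n b.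
Proof. exact: rmorphD. Qed.

Lemma yokonuma_to_heckeZ n k a :
  yokonuma_to_hecke n (k *: a) = k *: yokonuma_to_hecke n a.
Proof. exact: linearZ. Qed.

Lemma yokonuma_to_hecke1 n : yokonuma_to_hecke n 1 = 1.
Proof. exact: rmorph1. Qed.

Lemma yokonuma_to_hecke_tX n j k : yokonuma_to_hecke n (yt 1 q j ^+ k) = 1.
Proof.
elim: k => [|k IHk]; first by rewrite expr0 yokonuma_to_hecke1.
by rewrite exprS yokonuma_to_heckeM IHk yokonuma_to_hecke_t mulr1.
Qed.

Lemma yokonuma_to_hecke_surj n (h : H n) : exists y, h = yokonuma_to_hecke n y.
Proof.
elim/presented_ind: h => [|i|a b [y ->] [y' ->]|k a [y ->]|a b [y ->] [y' ->]].
- by exists 1; rewrite yokonuma_to_hecke1.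
- by exists (yg 1 q i); rewrite yokonuma_to_hecke_g.
- by exists (y + y'); rewrite yokonuma_to_heckeD.
- by exists (k *: y); rewrite yokonuma_to_heckeZ.
- by exists (y * y'); rewrite yokonuma_to_heckeM.
Qed.

Lemma yokonuma_to_hecke_inc n (y : Y n) :
  yokonuma_to_hecke n.+1 (yokonuma_inc 1 q n y) = inc (yokonuma_to_hecke n y).
Proof.
elim/yokonuma_ind: y => [|i|j|a b IHa IHb|k a IHa|a b IHa IHb].
- by rewrite yokonuma_inc1 !yokonuma_to_hecke1 hecke_inc1.
- by rewrite yokonuma_inc_g !yokonuma_to_hecke_g hecke_inc_gen.
- by rewrite yokonuma_inc_t !yokonuma_to_hecke_t hecke_inc1.
- by rewrite yokonuma_incD !yokonuma_to_heckeD hecke_incD IHa IHb.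
- by rewrite yokonuma_incZ !yokonuma_to_heckeZ hecke_incZ IHa.
- by rewrite yokonuma_incM !yokonuma_to_heckeM hecke_incM IHa IHb.
Qed.

(* The defining properties of the Ocneanu trace, for a family of functions that
   does not carry a bundled linearity proof. *)
Definition markov_family (zeta : K) (F : forall n, H n -> K) : Prop :=
  [/\ forall n k a b, F n (k *: a + b) = k * F n a + F n b,
      F 0%N 1 = 1,
      forall n a, F n.+1 (inc a) = F n a,
      forall n a b, F n (a * b) = F n (b * a)
    & forall n a, F n.+2 (inc a * @hG _ q n.+2 ord_max) = zeta * F n.+1 a].

(** Pull both families back along [yokonuma_to_hecke]. By the tower decomposition, the Markov
    properties determine the values at each level from those at the level below. *)
Lemma markov_family_unique zeta F F' :
  markov_family zeta F -> markov_family zeta F' ->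
  forall n h, F n h = F' n h.
Proof.
case=> FL F1 FI FC Fg [F'L F'1 F'I F'C F'g].
have F0 n : F n 0 = 0.
  by have := FL n 1 0 0; rewrite scaler0 add0r mul1r => /eqP; rewrite -subr_eq subrr => /eqP.
have F'0 n : F' n 0 = 0.
  by have := F'L n 1 0 0; rewrite scaler0 add0r mul1r => /eqP; rewrite -subr_eq subrr => /eqP.
have FD n a b : F n (a + b) = F n a + F n b by rewrite -[a]scale1r FL mul1r scale1r.
have F'D n a b : F' n (a + b) = F' n a + F' n b by rewrite -[a]scale1r F'L mul1r scale1r.
have FZ n k a : F n (k *: a) = k * F n a by rewrite -[k *: a]addr0 FL F0 addr0.
have F'Z n k a : F' n (k *: a) = k * F' n a by rewrite -[k *: a]addr0 F'L F'0 addr0.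
move=> n h; have [y ->] := yokonuma_to_hecke_surj h.
elim: n {h} y => [|n IHn] y.
  (* At level 0 there are no generators, so the algebra consists of scalars. *)
  have [k ->] : exists k, y = k *: 1.
    elim/yokonuma_ind: y => [|[]//|[]//|a b [k ->] [l ->]|k a [l ->]|a b [k ->] [l ->]].
    - by exists 1; rewrite scale1r.
    - by exists (k + l); rewrite scalerDl.
    - by exists (k * l); rewrite scalerA.
    - by exists (k * l); rewrite -scalerAl mul1r scalerA.
  by rewrite yokonuma_to_heckeZ yokonuma_to_hecke1 FZ F'Z F1 F'1.
elim: (tower_spanP y) => {y} [a b _ Qa _ Qb|k a _ Qa|a k|i a b iE].
- by rewrite yokonuma_to_heckeD FD F'D Qa Qb.
- by rewrite yokonuma_to_heckeZ FZ F'Z Qa.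
- by rewrite yokonuma_to_heckeM yokonuma_to_hecke_tX mulr1 yokonuma_to_hecke_inc FI F'I.
rewrite !yokonuma_to_heckeM !yokonuma_to_hecke_inc FC F'C mulrA -hecke_incM.
rewrite yokonuma_to_hecke_g -yokonuma_to_heckeM.
case: n IHn i a b iE => [|n] IHn i a b; first by case: i.
case=> iE; have -> : i = ord_max by apply: ord_inj.
by rewrite Fg F'g IHn.
Qed.

End HeckeMarkov.

(** * One-dimensional characters of the Hecke algebras *)

Section HeckeCharacter.
Variables (K : numFieldType) (q zeta : K).
Hypotheses (q_neq0 : q != 0) (zeta_neq0 : zeta != 0).
Hypothesis zetaP : zeta ^+ 2 = (q - 1) * zeta + q.
Local Notation H := (hecke q).
Local Notation G := (hG q).

Definition hecke_char n : {lrmorphism H n -> K^o}.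
Proof.
apply: (@hecke_lift K q n K^o (fun=> zeta)) => // i.
by rewrite zetaP /GRing.scale /= mulr1.
Defined.

Lemma hecke_char_g n i : hecke_char n (G i) = zeta.
Proof. exact: hecke_lift_gen. Qed.

Lemma hecke_charM n a b : hecke_char n (a * b) = hecke_char n a * hecke_char n b.
Proof. exact: rmorphM. Qed.

Lemma hecke_charD n a b : hecke_char n (a + b) = hecke_char n a + hecke_char n b.
Proof. exact: rmorphD. Qed.

Lemma hecke_charZ n k a : hecke_char n (k *: a) = k * hecke_char n a.
Proof. exact: linearZ. Qed.

Lemma hecke_char1 n : hecke_char n 1 = 1.
Proof. exact: rmorph1. Qed.

Lemma hecke_char_inc n (a : H n) : hecke_char n.+1 (hecke_inc q n a) = hecke_char n a.
Proof.
elim/presented_ind: a => [|i|a b IHa IHb|k a IHa|a b IHa IHb].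
- by rewrite hecke_inc1 !hecke_char1.
- by rewrite hecke_inc_gen !hecke_char_g.
- by rewrite hecke_incD !hecke_charD IHa IHb.
- by rewrite hecke_incZ !hecke_charZ IHa.
- by rewrite hecke_incM !hecke_charM IHa IHb.
Qed.

Lemma hecke_char_markov : markov_family zeta hecke_char.
Proof.
split=> [n k a b||n a|n a b|n a].
- by rewrite hecke_charD hecke_charZ.
- exact: hecke_char1.
- exact: hecke_char_inc.
- by rewrite !hecke_charM mulrC.
- by rewrite hecke_charM hecke_char_inc hecke_char_g mulrC.
Qed.

Lemma hecke_char_rep n (a : braid n) :
  hecke_char n (hecke_rep q a) = zeta ^ writhe a.
Proof.
rewrite /hecke_rep /braid_map /writhe; elim: (repr a) => [|[i b] w IHw].
  by rewrite /word_map /word_writhe !big_nil hecke_char1 expr0z.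
rewrite /word_map /word_writhe !big_cons hecke_charM IHw expfzDr //.
congr (_ * _); case: b => /=; first by rewrite hecke_char_g expr1z.
(* The image of [hGV i] is $(\zeta - q + 1)/q$, which is $\zeta^{-1}$ by the quadratic relation
   [zetaP]. *)
rewrite /hGV hecke_charZ hecke_charD hecke_char_g -scaleNr hecke_charZ hecke_char1 mulr1.
apply: (mulIf zeta_neq0); rewrite exprN1 mulVf //.
rewrite -mulrA mulrDl -expr2 zetaP mulNr addrC addKr mulVf //.
Qed.

End HeckeCharacter.

(** * Juyumaya traces that descend to Hecke algebras *)

Section Descent.
Variables (K : numFieldType) (d : nat) (u z : K) (x : nat -> K).
Local Notation Y := (yokonuma d u).
Local Notation g := (yg d u).
Local Notation gV := (ygV d u).
Variable tr : forall n, {scalar Y n}.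
Hypothesis trP : juyumaya_trace z x tr.
Variables (q c : K).
Hypotheses (u_neq0 : u != 0) (c_neq0 : c != 0) (q_neq0 : q != 0).
Hypothesis quadP : forall n (i : 'I_n.-1) (a : Y n),
  tr n (a * (c *: g i) ^+ 2) = (q - 1) * tr n (a * (c *: g i)) + q * tr n a.

Local Notation Fr n := (free_alg K 'I_n.-1).

Definition descent_eval n : {lrmorphism Fr n -> Y n} := feval (fun i => c *: g i).
Local Notation ev := descent_eval.

Lemma descent_evM n a b : ev n (a * b) = ev n a * ev n b.
Proof. exact: rmorphM. Qed.

Lemma descent_evD n a b : ev n (a + b) = ev n a + ev n b.
Proof. exact: rmorphD. Qed.

Lemma descent_evZ n k a : ev n (k *: a) = k *: ev n a.
Proof. exact: linearZ. Qed.

Lemma descent_ev1 n : ev n 1 = 1.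
Proof. exact: rmorph1. Qed.

Lemma descent_ev_gen n i : ev n (fgen i) = c *: g i.
Proof. exact: feval_gen. Qed.

(** The far and braid relations hold in the Yokonuma-Hecke algebra itself, and the quadratic one
    only under the trace, by [quadP]. The factors [a] and [b] let the induction pass through
    two-sided multiples; cyclicity gathers them on one side. *)
Lemma descent_ideal n (y : Fr n) : relation_ideal (@hecke_rel K q n) y ->
  forall a b, tr n (a * ev n y * b) = 0.
Proof.
elim=> {y} [y y' yy'||y y' _ IHy _ IHy'|f y _ IHy|f y _ IHy] a b.
- rewrite -mulrA (trC trP) -mulrA (trC trP) rmorphB.
  case: yy' => [i j ij|i j ij|i].
  + rewrite /= !descent_evM !descent_ev_gen -!scalerAl -!scalerAr yg_far // subrr mulr0.
    exact: raddf0.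
  + rewrite /= !descent_evM !descent_ev_gen -!scalerAl -!scalerAr -!scalerAl yg_braid // subrr mulr0.
    exact: raddf0.
  rewrite /= expr2 descent_evM descent_evD !descent_evZ descent_ev1 descent_ev_gen -expr2 mulrBr mulrDr -(scalerAr (q - 1)) -(scalerAr q) mulr1.
  have trB k l : tr n (k - l) = tr n k - tr n l by exact: raddfB.
  by rewrite trB quadP trD !trZ subrr.
- by rewrite rmorph0 mulr0 mul0r; exact: raddf0.
- by rewrite descent_evD mulrDr mulrDl trD IHy IHy' addr0.
- by rewrite descent_evM mulrA IHy.
- by rewrite descent_evM -mulrA -mulrA mulrA IHy.
Qed.

(** The assignment of [c *: g i] to $G_i$ need not factor through the Hecke algebra, but its trace
    does by [descent_ideal]; hence the value is taken on a representative. *)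
Definition descent n (h : hecke q n) : K := tr n (ev n (repr h)).

Lemma descent_class n (f : Fr n) :
  descent (pres_class (P := hecke_pres q n) f) = tr n (ev n f).
Proof.
rewrite /descent; have [y Iy ->] := repr_class (P := hecke_pres q n) f.
rewrite descent_evD trD -[ev n y]mul1r -[1 * _]mulr1 (descent_ideal Iy).
by rewrite addr0.
Qed.

Definition inc_free n : {lrmorphism Fr n -> Fr n.+1} :=
  feval (fun i : 'I_n.-1 => @fgen K 'I_n.+1.-1 (inc_gen i)).

Lemma inc_freeM n a b : inc_free n (a * b) = inc_free n a * inc_free n b.
Proof. exact: rmorphM. Qed.

Lemma inc_freeD n a b : inc_free n (a + b) = inc_free n a + inc_free n b.
Proof. exact: rmorphD. Qed.

Lemma inc_freeZ n k a : inc_free n (k *: a) = k *: inc_free n a.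
Proof. exact: linearZ. Qed.

Lemma inc_free1 n : inc_free n 1 = 1.
Proof. exact: rmorph1. Qed.

Lemma inc_free_gen n i : inc_free n (fgen i) = fgen (inc_gen i).
Proof. exact: feval_gen. Qed.

Lemma inc_free_class n (f : Fr n) :
  hecke_inc q n (pres_class (P := hecke_pres q n) f) =
  pres_class (P := hecke_pres q n.+1) (inc_free n f).
Proof.
move: f; apply: fp_ind => [|i|a b IHa IHb|k a IHa|a b IHa IHb].
- by rewrite inc_free1 !pclass1 hecke_inc1.
- rewrite inc_free_gen; exact: hecke_inc_gen.
- by rewrite inc_freeD !pclassD hecke_incD IHa IHb.
- by rewrite inc_freeZ !pclassZ hecke_incZ IHa.
- by rewrite inc_freeM !pclassM hecke_incM IHa IHb.
Qed.

Lemma ev_inc_free n (f : Fr n) : ev n.+1 (inc_free n f) = yokonuma_inc d u n (ev n f).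
Proof.
move: f; apply: fp_ind => [|i|a b IHa IHb|k a IHa|a b IHa IHb].
- by rewrite inc_free1 !descent_ev1 yokonuma_inc1.
- by rewrite inc_free_gen !descent_ev_gen yokonuma_incZ yokonuma_inc_g.
- by rewrite inc_freeD !descent_evD yokonuma_incD IHa IHb.
- by rewrite inc_freeZ !descent_evZ yokonuma_incZ IHa.
- by rewrite inc_freeM !descent_evM yokonuma_incM IHa IHb.
Qed.

Lemma descent_markov : markov_family (c * z) descent.
Proof.
split=> [n k a b||n a|n a b|n a].
- elim/presW: a => a; elim/presW: b => b.
  by rewrite -pclassZ -pclassD !descent_class descent_evD descent_evZ trD trZ.
- by rewrite -pclass1 descent_class descent_ev1 (tr_one trP).
- by elim/presW: a => a; rewrite inc_free_class !descent_class ev_inc_free (tr_inc trP).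
- elim/presW: a => a; elim/presW: b => b.
  by rewrite -!pclassM !descent_class !descent_evM (trC trP).
elim/presW: a => a; rewrite inc_free_class /hG /pgen -pclassM !descent_class.
rewrite descent_evM ev_inc_free descent_ev_gen -(scalerAr c) trZ (tr_g trP) // mulrA //.
Qed.

Lemma descent_rep n (a : braid n) :
  descent (hecke_rep q a) = c ^ writhe a * tr n (yokonuma_rep d u a).
Proof.
rewrite /hecke_rep /yokonuma_rep /braid_map /writhe.
pose V i : Fr n := q^-1 *: (fgen i - (q - 1)%:A).
have -> w : word_map (hG q (n := n)) (hGV q (n := n)) w =
    pres_class (P := hecke_pres q n) (word_map (@fgen K 'I_n.-1) V w).
  rewrite /word_map rmorph_prod; apply: eq_bigr => -[i b] _; case: b => //=.
  by rewrite /V pclassZ rmorphB /= pclassZ pclass1.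
rewrite descent_class.
(* The factor [b] collects the letters already read. It is needed because [V i] maps to the inverse
   of [c *: g i] only under the trace. *)
suff h b : tr n (b * ev n (word_map (@fgen K 'I_n.-1) V (repr a))) =
   c ^ word_writhe (repr a) * tr n (b * word_map (g (n := n)) (gV (n := n)) (repr a)).
  by have := h 1; rewrite !mul1r.
elim: (repr a) b => [|[i s] w IHw] b.
  by rewrite /word_map /word_writhe !big_nil descent_ev1 expr0z mul1r.
rewrite /word_map /word_writhe !big_cons descent_evM mulrA IHw expfzDr // -[RHS]mulrA.
rewrite [RHS]mulrCA; congr (_ * _); rewrite -/(word_map _ _ w).
move: (word_map _ _ w) => W; case: s => /=.
  by rewrite descent_ev_gen -(scalerAr c) -(scalerAl c) trZ expr1z mulrA.
rewrite exprN1 mulrA (trC trP) [in RHS](trC trP) !mulrA; move: (W * b) => y.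
have trgV k : tr n (y * gV i * (k *: g i)) = k * tr n y.
  by rewrite -(scalerAr k) trZ -mulrA ygVK // mulr1.
(* Multiplied by the inverse of [g i], the quadratic relation can be solved for the trace of
   [y * gV i]. *)
have := quadP i (y * gV i); rewrite trgV expr2 mulrA -!(scalerAr c) -(scalerAl c).
rewrite !trZ -(mulrA y) ygVK // mulr1 => quad.
rewrite /V descent_evZ descent_evD -scaleNr descent_evZ descent_ev_gen descent_ev1 -(scalerAr q^-1) mulrDr trZ trD.
rewrite -(scalerAr c) -(scalerAr (- (q - 1))) mulr1 !trZ.
have -> : tr n (y * gV i) = q^-1 * (c * (c * tr n (y * g i)) - (q - 1) * (c * tr n y)).
  by rewrite quad addrC addKr mulKf.
by field; rewrite c_neq0 q_neq0.
Qed.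

Lemma ocneanu_rep (tau : forall n, {scalar hecke q n}) : ocneanu_trace (c * z) tau ->
  forall n (a : braid n), tau n (hecke_rep q a) = c ^ writhe a * tr n (yokonuma_rep d u a).
Proof.
case=> tau0 tauI tauC taug n a; rewrite -descent_rep.
have tauM : markov_family (c * z) (fun n (h : hecke q n) => tau n h).
  by split=> // k l b b'; rewrite linearP.
exact: (markov_family_unique tauM descent_markov).
Qed.

End Descent.

(** * Traces that are characters on braids *)

Section CharacterTraces.
Variable K : numFieldType.

Lemma ocneanu_char (q zeta : K) (tau : forall n, {scalar hecke q n}) :
  q != 0 -> zeta != 0 -> zeta = q \/ zeta = -1 -> ocneanu_trace zeta tau ->
  forall n (a : braid n), tau n (hecke_rep q a) = zeta ^ writhe a.
Proof.
move=> q0 zeta0 zE [tau0 tauI tauC taug] n a.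
have zetaP : zeta ^+ 2 = (q - 1) * zeta + q by case: zE => ->; ring.
have tauM : markov_family zeta (fun n (h : hecke q n) => tau n h).
  by split=> // k l b b'; rewrite linearP.
rewrite -(hecke_char_rep q0 zeta0 zetaP).
exact: (markov_family_unique tauM (hecke_char_markov zetaP)).
Qed.

(** With [c = 1] the trace descends to the Hecke algebra of parameter [u], where [z] is a root of
    the quadratic relation; uniqueness identifies it with a character. *)
Lemma juyumaya_char d (u z : K) x (tr : forall n, {scalar yokonuma d u n}) :
  (0 < d)%N -> juyumaya_trace z x tr -> u != 0 -> z != 0 -> z = u \/ z = -1 ->
  (forall n (i : 'I_n.-1) (a : yokonuma d u n),
     tr n (a * yg d u i ^+ 2) = (u - 1) * tr n (a * yg d u i) + u * tr n a) ->
  forall n (a : braid n), tr n (yokonuma_rep d u a) = z ^ writhe a.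
Proof.
move=> d0 trP u0 z0 zE quadP n a.
have zP : z ^+ 2 = (u - 1) * z + u by case: zE => ->; ring.
have quad1 m (i : 'I_m.-1) (b : yokonuma d u m) :
    tr m (b * (1 *: yg d u i) ^+ 2) =
    (u - 1) * tr m (b * (1 *: yg d u i)) + u * tr m b.
  by rewrite scale1r.
have := descent_rep trP u0 (oner_neq0 K) u0 quad1 a.
rewrite exp1rz mul1r => <-; rewrite -(hecke_char_rep u0 z0 zP).
have dM := descent_markov trP quad1; rewrite mul1r in dM.
exact: (markov_family_unique dM (hecke_char_markov zP)).
Qed.

End CharacterTraces.

(** * The skein relation *)

Section SkeinSystem.
Variables (K : numFieldType) (d : nat) (u z : K) (x : nat -> K).
Local Notation Y := (yokonuma d u).
Local Notation inc := (yokonuma_inc d u _).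
Local Notation g := (yg d u).
Variable tr : forall n, {scalar Y n}.
Hypothesis d_gt0 : (0 < d)%N.
Hypothesis trP : juyumaya_trace z x tr.
Hypothesis xE : E_system d x.
Local Notation E := (trace_e tr).
Local Notation Z := (E + z).
Local Notation g0 := (g (ord0 : 'I_2.-1)).

Lemma yg_cube n (i : 'I_n.-1) : g i ^+ 3 = g i + ((u - 1) * u) *: yb d u i.
Proof.
by rewrite exprSr yg_sqr mulrDl mul1r -(scalerAl (u - 1)) yb_yg scalerA.
Qed.

Lemma yg_four n (i : 'I_n.-1) :
  g i ^+ 4 = 1 + ((u - 1) * (1 + u ^+ 2)) *: yb d u i.
Proof.
rewrite exprSr yg_cube mulrDl -expr2 yg_sqr -(scalerAl (_ * u)) yb_yg scalerA.
by rewrite -addrA -scalerDl; congr (_ + _ *: _); ring.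
Qed.

Lemma tr2_yg2 : tr 2 (g0 ^+ 2) = 1 + (u - 1) * Z.
Proof. by rewrite yg_sqr trD trZ (tr2_yb d_gt0 trP xE) (tr_one trP). Qed.

Lemma tr2_yg3 : tr 2 (g0 ^+ 3) = z + (u - 1) * u * Z.
Proof. by rewrite yg_cube trD trZ (tr2_yb d_gt0 trP xE) (tr2_yg trP). Qed.

Lemma tr2_yg4 : tr 2 (g0 ^+ 4) = 1 + (u - 1) * (1 + u ^+ 2) * Z.
Proof. by rewrite yg_four trD trZ (tr2_yb d_gt0 trP xE) (tr_one trP). Qed.

(** With $a$ the image of s2 s1^2 s2, these are the three traces in the skein relation at $a$ for
    the first generator. *)
Lemma tr3_values (i j : 'I_3.-1) : i = 0%N :> nat -> j = 1%N :> nat ->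
  let a := g j * g i ^+ 2 * g j in
  let w := 1 + (u - 1) * Z in
  [/\ tr 3 a = w ^+ 2,
      tr 3 (a * g i) = z * (1 + (u - 1) * (1 + u ^+ 2) * Z) &
      tr 3 (a * g i ^+ 2) = w ^+ 2 + (u - 1) *
        (Z * w + (u - 1) * (Z * (u * E + (u - 1) * z + u ^+ 2 * z)))].
Proof.
move=> i0 j1 a w; have ij : j = i.+1 :> nat by rewrite i0.
have ik : inc g0 = g i.
  by rewrite yokonuma_inc_g; congr (yg d u _); apply: val_inj.
have ib : inc (yb d u (ord0 : 'I_2.-1)) = yb d u i.
  by rewrite yokonuma_inc_yb; congr (yb d u _); apply: val_inj.
have trj (b : Y 2) : tr 3 (inc b * g j ^+ 2) = tr 2 b * w.
  rewrite yg_sqr mulrDr mulr1 -(scalerAr (u - 1)) trD trZ (tr_inc trP).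
  by rewrite (tr_yb d_gt0 trP xE) // /w; ring.
have ik2 : inc (g0 ^+ 2) = g i ^+ 2 by rewrite !expr2 yokonuma_incM ik.
have tra : tr 3 a = w ^+ 2.
  by rewrite /a -mulrA (trC trP) -mulrA -expr2 -ik2 trj tr2_yg2 -expr2.
split=> //.
- have -> : a * g i = g j * (g i ^+ 2 * g j * g i) by rewrite /a !mulrA.
  (* Cyclicity and one braid relation turn the product into [g i ^+ 4 * g j]. *)
  rewrite (trC trP) -[_ * g j]mulrA -mulrA (mulrA (g j)) yg_braid // !mulrA. rewrite -exprSr (trC trP).
  rewrite mulrA -exprS -ik.
  have -> : inc g0 ^+ 4 = inc (g0 ^+ 4).
    by rewrite !exprS expr0 !mulr1 !yokonuma_incM.
  by rewrite (tr_g trP) // tr2_yg4.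
rewrite yg_sqr mulrDr mulr1 trD tra -(scalerAr (u - 1)) trZ.
have -> : a * yb d u i = g j ^+ 2 * yb d u i + (u - 1) *: (g j * yb d u i * g j * yb d u i).
  rewrite /a yg_sqr mulrDr mulr1 !mulrDl -expr2 -(scalerAr (u - 1)).
  by rewrite -!(scalerAl (u - 1)).
rewrite trD trZ (tr_yb_far d_gt0 trP xE) // (trC trP) -{1}ib trj.
by rewrite (tr2_yb d_gt0 trP xE).
Qed.

(** The hypotheses are the relation $V(\alpha\sigma_1^2) = p\,V(\alpha\sigma_1) + b\,V(\alpha)$ at
    the braids 1, s1, s1^2 and s2 s1^2 s2. The cases split on whether $(u-1)W$, the difference
    between the traces of [g ^+ 2] and 1, vanishes. *)
Lemma skein_cases (E' p b : K) : u != 0 ->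
  let W := E' + z in let w := 1 + (u - 1) * W in
  w = p * z + b ->
  z + (u - 1) * u * W = p * w + b * z ->
  1 + (u - 1) * (1 + u ^+ 2) * W = p * (z + (u - 1) * u * W) + b * w ->
  w ^+ 2 + (u - 1) * (W * w + (u - 1) * (W * (u * E' + (u - 1) * z + u ^+ 2 * z)))
  = p * (z * (1 + (u - 1) * (1 + u ^+ 2) * W)) + b * w ^+ 2 ->
  (u - 1) * W = 0 /\ (p = 0 /\ b = 1 \/ z ^+ 2 = 1) \/
  E' = 1 /\ (z = u \/ p = u - 1 /\ b = u).
Proof.
move=> u0 W w h1 h2 h3 h4.
have [uW|uW] := eqVneq ((u - 1) * W) 0.
  left; split=> //; have w1 : w = 1 by rewrite /w uW addr0.
  have pz : p * (1 - z ^+ 2) = 0.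
    have -> : p * (1 - z ^+ 2) = p * w + b * z - z * (p * z + b) - p * ((u - 1) * W).
      by rewrite /w; ring.
    by rewrite -h2 -h1 mulrAC uW mul0r w1; ring.
  move/eqP: pz; rewrite mulf_eq0 subr_eq0 => /orP[/eqP p0|/eqP <-]; last by right.
  by left; split=> //; rewrite -w1 h1 p0 mul0r add0r.
right; move: uW; rewrite mulf_eq0 negb_or => /andP[u1 W0].
(* The third equation minus the first is divisible by $(u-1)W$; the quotient says that the
   eigenvalue $u$ of [g] on [y] is a root of $X^2 = pX + b$. *)
have bE : b = u ^+ 2 - p * u.
  apply: (mulIf W0); apply: (mulfI u1); apply/eqP.
  rewrite -subr_eq0 -mulrBr -mulrBl.
  have -> : (u - 1) * ((b - (u ^+ 2 - p * u)) * W) = w - (p * z + b)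
      - (1 + (u - 1) * (1 + u ^+ 2) * W - (p * (z + (u - 1) * u * W) + b * w)).
    by rewrite /w; ring.
  by rewrite h3 -h1 !subrr.
have e1 : p * (u - z) = (u - 1) * (u + 1 - W).
  have -> : p * (u - z) = u ^+ 2 - (p * z + b) by rewrite bE; ring.
  by rewrite -h1 /w; ring.
have e2 : p * (1 + (u - 1) * W - u * z) = (u - 1) * (u * W - (u + 1) * z).
  have -> : p * (1 + (u - 1) * W - u * z) = p * w + b * z - u ^+ 2 * z.
    by rewrite bE /w; ring.
  by rewrite -h2; ring.
(* Eliminating [b] and [p] from the fourth equation by the first two leaves $(u-1)^2 W (u+1)(E'-1) =
   0$. *)
have e4 : (u + 1) * (E' - 1) = 0.
  apply: (mulfI W0); apply: (mulfI u1); apply: (mulfI u1); rewrite !mulr0.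
  have -> : (u - 1) * ((u - 1) * (W * ((u + 1) * (E' - 1)))) =
    w ^+ 2 + (u - 1) * (W * w + (u - 1) * (W * (u * E' + (u - 1) * z + u ^+ 2 * z)))
    - (p * (z * (1 + (u - 1) * (1 + u ^+ 2) * W)) + b * w ^+ 2)
    - w * (w - (p * z + b))
    - (u - 1) * W * u * (p * (1 + (u - 1) * W - u * z)
                         - (u - 1) * (u * W - (u + 1) * z)).
    by rewrite bE /w /W; ring.
  by rewrite h4 e2 -h1 !subrr !mulr0 !subrr.
have E1 : E' = 1.
  move/eqP: e4; rewrite mulf_eq0 => /orP[|]; last by rewrite subr_eq0 => /eqP.
  rewrite addr_eq0 => /eqP uN1.
  (* For $u = -1$ the value of $E'$ comes instead from the difference of [e1] and [e2], which is
     $2p(E'-1) = 0$. *)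
  have p0 : p != 0.
    apply/eqP => p0; move: e1; rewrite p0 mul0r uN1 => /esym/eqP.
    rewrite mulf_eq0 addNr sub0r oppr_eq0 (negPf W0) orbF.
    by rewrite -opprD oppr_eq0 -(natrD _ 1 1) pnatr_eq0.
  apply/eqP; rewrite -subr_eq0; apply/eqP.
  have : p * (E' - 1) * 2%:R = 0.
    have -> : p * (E' - 1) * 2%:R = - (p * (1 + (u - 1) * W - u * z) - (u - 1) * (u * W - (u + 1) * z))
      + (p * (u - z) - (u - 1) * (u + 1 - W)).
      by rewrite uN1 /W; ring.
    by rewrite e1 e2 !subrr oppr0 addr0.
  by move=> /eqP; rewrite !mulf_eq0 (negPf p0) pnatr_eq0 orbF => /eqP.
split=> //; move/eqP: e1; rewrite -subr_eq0.
have -> : p * (u - z) - (u - 1) * (u + 1 - W) = (p - (u - 1)) * (u - z).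
  by rewrite /W E1; ring.
rewrite mulf_eq0 !subr_eq0 => /orP[/eqP pE|/eqP <-]; last by left.
by right; split=> //; rewrite bE pE; ring.
Qed.

End SkeinSystem.

(** * The writhe, and maps on links determined by their values on braids *)

Lemma writheM n (a b : braid n) : writhe (a * b)%g = writhe a + writhe b.
Proof.
elim/braidW: a => v; elim/braidW: b => w.
have -> : (braid_class v * braid_class w)%g = braid_class (v ++ w) by exact: class_cat.
by rewrite !writheE /word_writhe big_cat.
Qed.

Lemma writhe_sigma n (i : 'I_n.-1) : writhe (sigma i) = 1.
Proof. by rewrite writheE /word_writhe big_seq1. Qed.

Lemma writhe1 n : writhe (1%g : braid n) = 0.
Proof.
have -> : 1%g = braid_class [::] :> braid n by [].
by rewrite writheE /word_writhe big_nil.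
Qed.

Lemma braid_closure_eq (T : Type) (P Delta : oriented_link -> T) :
  (forall n (a : braid n.+1), P (braid_closure a) = Delta (braid_closure a)) ->
  P = Delta.
Proof.
move=> PD; apply: boolp.funext => L; rewrite -[L]reprK.
by case: (repr L) => n a; apply: PD.
Qed.

Lemma yokonuma_rep1 (K : numFieldType) d (u : K) n : u != 0 ->
  yokonuma_rep d u (1%g : braid n) = 1.
Proof.
by move=> u0; apply: braid_map1 => *; [exact: ygK|exact: ygVK|exact: yg_far|exact: yg_braid].
Qed.

(** * Comparison of the two invariants *)

Section Comparison.
Variables (K : numFieldType) (d : nat) (q zeta u z : K) (x : nat -> K).
Variables (tau : forall n, {scalar hecke q n}) (tr : forall n, {scalar yokonuma d u n}).
Hypotheses (d_gt0 : (0 < d)%N) (q_neq0 : q != 0) (zeta_neq0 : zeta != 0).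
Hypotheses (u_neq0 : u != 0) (z_neq0 : z != 0).
Hypotheses (xE : E_system d x) (tauP : ocneanu_trace zeta tau).
Hypothesis trP : juyumaya_trace z x tr.
Local Notation E := (trace_e tr).
Local Notation g := (yg d u).
Local Notation V := (fun n a => tr n (yokonuma_rep d u a)).

Lemma tr_sqr_E1 n (i : 'I_n.-1) (a : yokonuma d u n) : E = 1 ->
  tr n (a * g i ^+ 2) = (u - 1) * tr n (a * g i) + u * tr n a.
Proof.
move=> E1; have [_ /(_ E1) xM] := E_system_solution d_gt0 (E_systemE d_gt0 trP xE).
have tre b : tr n (b * ye d u i) = tr n b by exact: (tr_mul_e d_gt0 trP xM).
have treg : tr n (a * (ye d u i * g i)) = tr n (a * g i).
  by rewrite mulrA (trC trP) mulrA tre (trC trP).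
rewrite yg_sqr ybE mulrDr mulr1 -(scalerAr (u - 1)) !mulrDr mulr1 trD trZ trD tre.
rewrite treg; ring.
Qed.

(** Under the trace [g i] is an involution: the term $(u-1)y_i$ of its square vanishes or has trace
    zero. The coefficients 0 and 1 match the form used in [values_of_scaling]. *)
Lemma tr_sqr_involution n (i : 'I_n.-1) (a : yokonuma d u n) : u = 1 \/ z = - E ->
  tr n (a * g i ^+ 2) = 0 * tr n (a * g i) + 1 * tr n a.
Proof.
rewrite mul0r add0r mul1r yg_sqr mulrDr mulr1 -(scalerAr (u - 1)) trD trZ.
case=> [u1|zE]; first by rewrite [X in X - 1]u1 subrr mul0r addr0.
case: n i a => [[]//|n] i a.
by rewrite (tr_yb_eq0 d_gt0 trP xE _ _ zE) mulr0 addr0.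
Qed.

Section Values.
Variables sH sY : K.
Hypothesis sHY : zeta * sH = z * sY.

(** The elements [c *: g i] satisfy the Hecke relation under the trace, so the two traces differ by
    [c ^ writhe a]; this factor is absorbed by the normalisations because $c\,s_H = s_Y$. *)
Lemma values_of_scaling (A B c : K) : zeta = c * z -> c * A = q - 1 -> c ^+ 2 * B = q ->
  (forall n (i : 'I_n.-1) (a : yokonuma d u n),
    tr n (a * g i ^+ 2) = A * tr n (a * g i) + B * tr n a) ->
  forall n (a : braid n.+1), homflypt_value zeta sH tau a = delta_value z sY tr a.
Proof.
move=> zetaE cA cB quadP n a.
have c0 : c != 0 by apply: contra_neq zeta_neq0 => c0; rewrite zetaE c0 mul0r.
have cs : c * sH = sY by apply: (mulfI z_neq0); rewrite -sHY zetaE mulrCA mulrA.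
have quadc m (i : 'I_m.-1) b :
    tr m (b * (c *: g i) ^+ 2) = (q - 1) * tr m (b * (c *: g i)) + q * tr m b.
  rewrite exprZn -(scalerAr (c ^+ 2)) -(scalerAr c) !trZ quadP -cA -cB; ring.
have tauP' : ocneanu_trace (c * z) tau by rewrite -zetaE.
rewrite /homflypt_value /delta_value (ocneanu_rep trP u_neq0 c0 q_neq0 quadc tauP').
by rewrite sHY mulrA -(mulrA _ (sH ^ _)) -expfzMl [sH * c]mulrC cs.
Qed.

(** Both values equal a common power of $1/(z s_Y)$ times $(\zeta s_H)^{\epsilon} = (z
    s_Y)^{\epsilon}$. *)
Lemma values_of_characters : zeta = q \/ zeta = -1 -> z = u \/ z = -1 ->
  (forall n (i : 'I_n.-1) (a : yokonuma d u n),
    tr n (a * g i ^+ 2) = (u - 1) * tr n (a * g i) + u * tr n a) ->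
  forall n (a : braid n.+1), homflypt_value zeta sH tau a = delta_value z sY tr a.
Proof.
move=> zetaE zE quadP n a; rewrite /homflypt_value /delta_value.
rewrite (ocneanu_char q_neq0 zeta_neq0 zetaE tauP).
rewrite (juyumaya_char d_gt0 trP u_neq0 z_neq0 zE quadP) sHY -!mulrA.
by rewrite -!expfzMl [sH * _]mulrC [sY * _]mulrC sHY.
Qed.

End Values.

Section Skein.
Variables sH sY : K.
Hypotheses (sH_neq0 : sH != 0) (sY_neq0 : sY != 0).
Hypothesis PD : forall n (a : braid n.+1),
  homflypt_value zeta sH tau a = delta_value z sY tr a.

(* The two-component unlink has values 1/(zeta sH) and 1/(z sY). *)
Lemma unlink_values : zeta * sH = z * sY.
Proof.
have tau1 n : tau n 1 = 1.
  by case: tauP => t0 tI _ _; elim: n => // n IHn; rewrite -(hecke_inc1 q) tI.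
have := PD (1%g : braid 2); rewrite /homflypt_value /delta_value writhe1 !expr0z !mulr1.
have -> : hecke_rep q (1%g : braid 2) = 1.
  by apply: braid_map1 => *; [exact: hGK|exact: hGVK|exact: hG_far|exact: hG_braid].
rewrite yokonuma_rep1 // tau1 (tr_one trP) !mulr1 !expr1 !div1r => /invr_inj.
by [].
Qed.

Lemma scaled_traces n (a : braid n.+1) :
  V n.+1 a = (sH / sY) ^ writhe a * tau n.+1 (hecke_rep q a).
Proof.
have := PD a; rewrite /homflypt_value /delta_value unlink_values -!mulrA.
have D0 : (1 / (z * sY)) ^+ n != 0.
  by rewrite expf_neq0 // mul1r invr_eq0 mulf_neq0.
move=> /(mulfI D0) h; rewrite expfzMl exprz_inv -mulrA.
apply: (mulfI (expfz_neq0 (writhe a) sY_neq0)).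
rewrite -h [RHS]mulrCA; congr (_ * _).
by rewrite mulrA -expfzDr // subrr expr0z mul1r.
Qed.

Lemma skein_relation n (a : braid n.+1) (i : 'I_n) :
  V n.+1 (a * sigma (i : 'I_n.+1.-1) * sigma (i : 'I_n.+1.-1))%g =
  sH / sY * (q - 1) * V n.+1 (a * sigma (i : 'I_n.+1.-1))%g +
  (sH / sY) ^+ 2 * q * V n.+1 a.
Proof.
have r0 : sH / sY != 0 by rewrite mulf_neq0 ?invr_eq0.
rewrite !scaled_traces !writheM !writhe_sigma !expfzDr // !expr1z.
have tauQ (h : hecke q n.+1) (k : 'I_n.+1.-1) :
    tau n.+1 (h * hG q k * hG q k) = (q - 1) * tau n.+1 (h * hG q k) + q * tau n.+1 h.
  rewrite -mulrA -expr2 hG_quad mulrDr -(scalerAr (q - 1)) -(scalerAr q) mulr1.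
  by rewrite raddfD /= !linearZ.
by rewrite !hecke_repM // !hecke_rep_sigma // tauQ; ring.
Qed.

Lemma skein_conclusion :
  let r := sH / sY in
  (u - 1) * (E + z) = 0 /\ (r * (q - 1) = 0 /\ r ^+ 2 * q = 1 \/ z ^+ 2 = 1) \/
  E = 1 /\ (z = u \/ r * (q - 1) = u - 1 /\ r ^+ 2 * q = u).
Proof.
move=> r; have s2 := @skein_relation 1 _ ord0.
pose s0 : braid 2 := sigma (ord0 : 'I_2.-1).
pose i : 'I_3.-1 := ord0; pose j : 'I_3.-1 := ord_max.
have [||t1 t2 t3] := tr3_values d_gt0 trP xE (i := i) (j := j); [by []|by []|].
have rep_s0 : yokonuma_rep d u s0 = g (ord0 : 'I_2.-1) by exact: yokonuma_rep_sigma.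
apply: (skein_cases u_neq0).
- have := s2 1%g; rewrite mul1g -/s0 yokonuma_repM // rep_s0 yokonuma_rep1 //.
  by rewrite -expr2 (tr2_yg2 d_gt0 trP xE) (tr2_yg trP) (tr_one trP) mulr1.
- have := s2 s0; rewrite -/s0 !yokonuma_repM // rep_s0 -expr2 -exprSr.
  by rewrite (tr2_yg2 d_gt0 trP xE) (tr2_yg3 d_gt0 trP xE) (tr2_yg trP).
- have := s2 (s0 * s0)%g; rewrite -/s0 !yokonuma_repM // rep_s0 -expr2 -!exprSr.
  by rewrite (tr2_yg2 d_gt0 trP xE) (tr2_yg3 d_gt0 trP xE) (tr2_yg4 d_gt0 trP xE).
have := @skein_relation 2 (sigma j * sigma i * sigma i * sigma j)%g i.
rewrite !yokonuma_repM // !yokonuma_rep_sigma // -(mulrA (g j)) -expr2.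
by rewrite -[_ * g i * g i]mulrA -expr2 t1 t2 t3.
Qed.

End Skein.

Variables sH sY : K.
Hypotheses (lambdaH_neq0 : lambdaH q zeta != 0) (lambdaY_neq0 : lambdaY u z E != 0).
Hypotheses (sHP : sH ^+ 2 = lambdaH q zeta) (sYP : sY ^+ 2 = lambdaY u z E).

Let sH_neq0 : sH != 0.
Proof. by apply: contraNneq lambdaH_neq0 => s0; rewrite -sHP s0 expr0n. Qed.

Let sY_neq0 : sY != 0.
Proof. by apply: contraNneq lambdaY_neq0 => s0; rewrite -sYP s0 expr0n. Qed.

Definition coincidence_cases (E' : K) : Prop :=
  (q = 1 /\ zeta = z /\ u = 1)
  \/ (q = 1 /\ zeta = - z /\ u = 1)
  \/ (zeta = q /\ u = 1 /\ z = 1)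
  \/ (zeta = q /\ u = 1 /\ z = - 1)
  \/ (zeta = - 1 /\ u = 1 /\ z = 1)
  \/ (zeta = - 1 /\ u = 1 /\ z = - 1)
  \/ (q = 1 /\ zeta = E' /\ z = - E')
  \/ (q = 1 /\ zeta = - E' /\ z = - E')
  \/ (zeta = q /\ z = - 1 /\ E' = 1)
  \/ (zeta = q /\ z = u /\ E' = 1)
  \/ (zeta = - 1 /\ z = - 1 /\ E' = 1)
  \/ (zeta = - 1 /\ z = u /\ E' = 1)
  \/ (q = u /\ zeta = z /\ E' = 1)
  \/ (q = 1 / u /\ zeta = - z / u /\ E' = 1).

(** The hypotheses give $\zeta^2\lambda_{\mathcal H} = \zeta(\zeta + 1 - q)/q = 1$, that is $(\zeta
    - q)(\zeta + 1) = 0$. *)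
Lemma zeta_character : z ^+ 2 * lambdaY u z E = 1 -> zeta * sH = z * sY ->
  zeta = q \/ zeta = -1.
Proof.
rewrite -sYP -exprMn => zY1 sHY; have := zY1; rewrite -sHY exprMn sHP.
have -> : zeta ^+ 2 * lambdaH q zeta = zeta * (zeta + (1 - q)) / q.
  by rewrite /lambdaH; field; rewrite q_neq0 zeta_neq0.
move/(congr1 ( *%R^~ q)); rewrite mulfVK // mul1r => zq.
have : (zeta - q) * (zeta + 1) == 0.
  by apply/eqP; rewrite -[in RHS](subrr q) -{2}zq; ring.
by rewrite mulf_eq0 subr_eq0 addr_eq0 => /orP[] /eqP; [left|right].
Qed.

Lemma coincidence_necessary :
  (forall n (a : braid n.+1), homflypt_value zeta sH tau a = delta_value z sY tr a) ->
  coincidence_cases E.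
Proof.
move=> PD; have sHY := unlink_values PD.
have rE : sH / sY = z / zeta.
  apply: (mulIf sY_neq0); apply: (mulfI zeta_neq0).
  by rewrite mulfVK // sHY mulrA mulrCA mulfV // mulr1.
have zsign : (z / zeta) ^+ 2 = 1 -> zeta = z \/ zeta = - z.
  move=> /eqP; rewrite sqrf_eq1 => /orP[] /eqP h.
    by left; rewrite -[LHS]mul1r -h mulfVK.
  by right; rewrite -[z](@mulfVK _ zeta) // h mulN1r opprK.
have [EN1 _] := E_system_solution d_gt0 (E_systemE d_gt0 trP xE).
have lY1 : u = 1 \/ z = - E -> lambdaY u z E = 1.
  rewrite /lambdaY => uz; have -> : z + (1 - u) * E = u * z.
    by case: uz => [u1|zE]; [rewrite [X in 1 - X]u1 [X in X * z]u1|rewrite zE]; ring.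
  by rewrite divff // mulf_neq0.
rewrite /coincidence_cases.
case: (skein_conclusion sH_neq0 sY_neq0 PD); rewrite rE.
  move=> [/eqP]; rewrite mulf_eq0 subr_eq0 addrC addr_eq0.
  move=> uz; have {}uz : u = 1 \/ z = - E by case/orP: uz => /eqP; [left|right].
  case=> [[/eqP]|/eqP z1].
    rewrite mulf_eq0 (negPf (mulf_neq0 z_neq0 _)) ?invr_eq0 // subr_eq0.
    move=> /eqP q1; rewrite q1 mulr1 => /zsign ze.
    case: uz => [u1|zE]; case: ze => ze; [tauto|tauto| |].
      by right; right; right; right; right; right; right; left; rewrite ze.
    by do 6 right; left; rewrite ze zE opprK.
  have zc : zeta = q \/ zeta = -1.
    by apply: zeta_character => //; rewrite lY1 // mulr1; apply/eqP.
  move: z1 uz; rewrite sqrf_eq1 => /orP[] /eqP z1; case=> [u1|zE]; try tauto.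
    (* Here $z = 1$ and $z = -E$, which the E-system excludes. *)
    by case/eqP: EN1; rewrite -[E]opprK -zE z1.
  have E1 : E = 1 by rewrite -[E]opprK -zE z1 opprK.
  tauto.
case=> E1 [zu|[pE bE]].
  have zc : zeta = q \/ zeta = -1.
    apply: zeta_character => //; rewrite /lambdaY E1 zu.
    by field; rewrite u_neq0.
  tauto.
have zr : z = z / zeta * zeta by rewrite mulfVK.
move: (z / zeta) zr zsign pE bE => r zr zsign pE bE.
(* If $q = u$ then $r^2 = 1$: the sign $r = 1$ gives $\zeta = z$, and $r = -1$ forces $q = 1$. *)
have q_eq_u : q = u -> q = 1 /\ zeta = - z /\ u = 1 \/ q = u /\ zeta = z /\ E = 1.
  move=> qu; have r2 : r ^+ 2 = 1 by apply: (mulIf q_neq0); rewrite bE mul1r.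
  case: (zsign r2) => ze; first by right.
  left; suff q1 : q = 1 by rewrite -qu.
  have rN1 : r = -1.
    by apply: (mulIf zeta_neq0); rewrite -zr ze mulN1r opprK.
  apply/eqP; rewrite -subr_eq0 -(mulrI_eq0 _ (mulfI (_ : 2%:R != 0))) ?pnatr_eq0 //.
  by rewrite mulr_natl mulr2n {2}qu -pE rN1 mulN1r subrr.
(* Eliminate $r$ from $r(q-1) = u-1$ and $r^2 q = u$. *)
have : (q - u) * (q * u - 1) == 0.
  have -> : (q - u) * (q * u - 1) = u * (q - 1) ^+ 2 - q * (u - 1) ^+ 2 by ring.
  by rewrite -pE -[in X in X - _]bE subr_eq0; apply/eqP; ring.
rewrite mulf_eq0 !subr_eq0 => /orP[] /eqP qu; first by have := q_eq_u qu; tauto.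
have qE : q = 1 / u by rewrite div1r; apply: (mulIf u_neq0); rewrite qu mulVf.
have : (u - 1) * (r + u) == 0.
  have -> : (u - 1) * (r + u) = u * (u - 1) - (r * (q * u) - r * u) by rewrite qu; ring.
  by rewrite -pE; apply/eqP; ring.
rewrite mulf_eq0 subr_eq0 addr_eq0 => /orP[] /eqP ru.
  have := q_eq_u _; rewrite qE [X in 1 / X]ru divr1 => /(_ (esym ru)); tauto.
have ze : zeta = - z / u.
  by rewrite zr ru; field; rewrite u_neq0.
tauto.
Qed.

(** In each case $\zeta^2\lambda_{\mathcal H} = z^2\lambda_{\mathrm Y}$ is checked first, so that
    the square roots are compatible; then either both traces are characters, or one is obtained from
    the other by scaling the generators. *)
Lemma coincidence_sufficient :
  (zeta ^+ 2 * lambdaH q zeta = z ^+ 2 * lambdaY u z E -> zeta * sH = z * sY) ->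
  coincidence_cases E ->
  forall n (a : braid n.+1), homflypt_value zeta sH tau a = delta_value z sY tr a.
Proof.
move=> sHY.
have lH1 : zeta = q \/ zeta = -1 -> zeta ^+ 2 * lambdaH q zeta = 1.
  by rewrite /lambdaH => -[] ->; field.
have lY1 : E = 1 -> z = u \/ z = -1 -> z ^+ 2 * lambdaY u z E = 1.
  by rewrite /lambdaY => -> -[] ->; field.
have lYu : u = 1 -> z ^+ 2 * lambdaY u z E = z ^+ 2.
  by rewrite /lambdaY => u1; rewrite [X in 1 - X]u1 [X in X * z]u1; field; rewrite z_neq0.
have lYE : z = - E -> z ^+ 2 * lambdaY u z E = z ^+ 2.
  rewrite /lambdaY => zE; have -> : z + (1 - u) * E = u * z by rewrite zE; ring.
  by rewrite divff ?mulr1 // mulf_neq0.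
have lHq : q = 1 -> zeta ^+ 2 * lambdaH q zeta = zeta ^+ 2.
  by rewrite /lambdaH => ->; field; rewrite zeta_neq0.
have sgn1 : u = 1 -> forall n (i : 'I_n.-1) (a : yokonuma d u n),
    tr n (a * g i ^+ 2) = (u - 1) * tr n (a * g i) + u * tr n a.
  move=> u1 n i a; rewrite tr_sqr_involution; last by left.
  by rewrite [X in _ = (X - 1) * _ + _]u1 [X in _ = _ + X * _]u1 subrr.
have character : zeta = q \/ zeta = -1 -> z = u \/ z = -1 ->
    z ^+ 2 * lambdaY u z E = 1 -> u = 1 \/ E = 1 ->
    forall n (a : braid n.+1), homflypt_value zeta sH tau a = delta_value z sY tr a.
  move=> zetaE zE lY uE; apply: values_of_characters => //; first by rewrite sHY // lH1 // lY.
  by case: uE => [/sgn1 //|E1] n i a; apply: tr_sqr_E1.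
have involution (c : K) : q = 1 -> zeta = c * z -> c ^+ 2 = 1 -> u = 1 \/ z = - E ->
    forall n (a : braid n.+1), homflypt_value zeta sH tau a = delta_value z sY tr a.
  move=> q1 ze c2 uz; apply: (values_of_scaling _ ze (A := 0) (B := 1)).
  - apply: sHY; rewrite lHq // ze exprMn c2 mul1r.
    by case: uz => [/lYu|/lYE].
  - by rewrite mulr0 q1 subrr.
  - by rewrite mulr1 q1.
  - by move=> n i a; apply: tr_sqr_involution.
have N1 : (-1) ^+ 2 = 1 :> K by rewrite sqrrN expr1n.
case=> [[q1 [ze u1]]|].
  by apply: (involution 1); rewrite ?mul1r ?expr1n //; left.
case=> [[q1 [ze u1]]|].
  by apply: (involution (-1)); rewrite ?mulN1r //; left.
case=> [[ze [u1 z1]]|].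
  by apply: character; rewrite ?lYu // ?z1 ?expr1n ?u1; tauto.
case=> [[ze [u1 z1]]|].
  by apply: character; rewrite ?lYu // ?z1 ?N1; tauto.
case=> [[ze [u1 z1]]|].
  by apply: character; rewrite ?lYu // ?z1 ?expr1n ?u1; tauto.
case=> [[ze [u1 z1]]|].
  by apply: character; rewrite ?lYu // ?z1 ?N1; tauto.
case=> [[q1 [ze zE]]|].
  by apply: (involution (-1)); rewrite ?mulN1r ?zE ?opprK //; right.
case=> [[q1 [ze zE]]|].
  by apply: (involution 1); rewrite ?mul1r ?expr1n ?zE //; right.
do 4![case=> [[ze [zE E1]]|]; first by apply: character => //; try apply: lY1; tauto].
case=> [[qu [ze E1]]|[qu [ze E1]]].
  apply: (values_of_scaling _ (c := 1) (A := u - 1) (B := u)).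
  - by apply: sHY; rewrite /lambdaH /lambdaY E1 qu ze mulr1.
  - by rewrite mul1r.
  - by rewrite mul1r qu.
  - by rewrite expr1n mul1r qu.
  - by move=> n i a; apply: tr_sqr_E1.
(* Scaling by $c = -1/u$ sends the roots $u$ and $-1$ of the quadratic relation to $-1$ and $1/u =
   q$. *)
apply: (values_of_scaling _ (c := - u^-1) (A := u - 1) (B := u)).
- by apply: sHY; rewrite /lambdaH /lambdaY E1 qu ze; field; rewrite u_neq0 z_neq0.
- by rewrite ze; field; rewrite u_neq0.
- by rewrite qu; field; rewrite u_neq0.
- by rewrite qu; field; rewrite u_neq0.
- by move=> n i a; apply: tr_sqr_E1.
Qed.

End Comparison.

Theorem theorem5 (R : realType) (d : nat) (d_gt0 : (0 < d)%N)
    (q zeta u z : R[i])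
    (q_neq0 : q != 0) (zeta_neq0 : zeta != 0) (u_neq0 : u != 0) (z_neq0 : z != 0)
    (x : nat -> R[i]) (xE : E_system d x)
    (tau : forall n : nat, {scalar hecke q n}) (tauP : ocneanu_trace zeta tau)
    (trS : forall n : nat, {scalar yokonuma d u n})
    (trSP : juyumaya_trace z x trS)
    (lambdaH_neq0 : lambdaH q zeta != 0)
    (lambdaY_neq0 : lambdaY u z (trace_e trS) != 0)
    (sH sY : R[i])
    (sHP : sH ^+ 2 = lambdaH q zeta)
    (sYP : sY ^+ 2 = lambdaY u z (trace_e trS))
    (sHY : zeta ^+ 2 * lambdaH q zeta = z ^+ 2 * lambdaY u z (trace_e trS) ->
       zeta * sH = z * sY)
    (P Delta : oriented_link -> R[i])
    (PP : forall (n : nat) (a : braid n.+1),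
       P (braid_closure a) = homflypt_value zeta sH tau a)
    (DeltaP : forall (n : nat) (a : braid n.+1),
       Delta (braid_closure a) = delta_value z sY trS a) :
  let E := trace_e trS in
  P = Delta <->
  (q = 1 /\ zeta = z /\ u = 1)
  \/ (q = 1 /\ zeta = - z /\ u = 1)
  \/ (zeta = q /\ u = 1 /\ z = 1)
  \/ (zeta = q /\ u = 1 /\ z = - 1)
  \/ (zeta = - 1 /\ u = 1 /\ z = 1)
  \/ (zeta = - 1 /\ u = 1 /\ z = - 1)
  \/ (q = 1 /\ zeta = E /\ z = - E)
  \/ (q = 1 /\ zeta = - E /\ z = - E)
  \/ (zeta = q /\ z = - 1 /\ E = 1)
  \/ (zeta = q /\ z = u /\ E = 1)
  \/ (zeta = - 1 /\ z = - 1 /\ E = 1)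
  \/ (zeta = - 1 /\ z = u /\ E = 1)
  \/ (q = u /\ zeta = z /\ E = 1)
  \/ (q = 1 / u /\ zeta = - z / u /\ E = 1).
Proof.
move=> E; split=> [PD|cases].
  apply: (coincidence_necessary d_gt0 q_neq0 zeta_neq0 u_neq0 z_neq0 xE tauP trSP
            lambdaH_neq0 lambdaY_neq0 sHP sYP) => n a.
  by rewrite -PP -DeltaP PD.
apply: braid_closure_eq => n a; rewrite PP DeltaP.
exact: (coincidence_sufficient d_gt0 q_neq0 zeta_neq0 u_neq0 z_neq0 xE tauP trSP
          sHY cases).
Qed.
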